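(* Let $\Bbbk$ be a field of characteristic $0$ and let $\Delta$ be a $2$-dimensional pseudomanifold without boundary, on $n$ vertices, that is a planar triangulation. Let $A(\Delta)=\Bbbk[x_1,\ldots,x_n]/\langle x_1^2,\ldots,x_n^2,I_\Delta\rangle$, where $I_\Delta$ is the Stanley-Reisner ideal of $\Delta$. Then the Weak Lefschetz Property (WLP) holds in degree $2$ for $A(\Delta)$ if and only if the $1$-skeleton $G(\Delta)$ is not Eulerian.
   Context: A simplicial complex $\Delta$ on a finite non-empty vertex set $V=\{1,\ldots,n\}$ is a non-empty collection of subsets (faces) of $V$ closed under taking subsets; a face with $k+1$ elements is a $k$-simplex; facets are the inclusion-maximal faces. The Stanley-Reisner ideal is $I_\Delta=\langle x_{i_1}\cdots x_{i_m} : \{i_1,\ldots,i_m\}\notin\Delta\rangle$. The $1$-skeleton $G(\Delta)$ is the graph formed by the $0$-faces (vertices) and $1$-faces (edges) of $\Delta$. WLP holds for a standard graded Artinian algebra $A$ in degree $i$ if, for a general linear form $\ell$, the multiplication map $\times\ell: A_i\to A_{i+1}$ is injective or surjective. A $2$-dimensional pseudomanifold is a simplicial complex such that: each facet is a $2$-simplex; every $1$-simplex is a face of at least one and at most two $2$-simplices; and given any two $2$-simplices $F_1,F_k$ there is a chain of $2$-simplices $F_1,F_2,\ldots,F_k$ such that $F_i\cap F_{i+1}$ is a $1$-simplex for $1\le i\le k-1$. It is without boundary if no $1$-simplex is a face of exactly one $2$-simplex. A simplicial complex is a triangulation if its geometric realization is homeomorphic to a topological manifold. The triangulation $\Delta$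 is planar if its graph $G(\Delta)$ can be embedded in the plane (is a planar graph). A graph is Eulerian if and only if it has no vertex of odd degree. *)

(* Defs.v *)
From HB Require Import structures.
From mathcomp Require Import all_boot all_order all_algebra.
From mathcomp Require Import generic_quotient ring_quotient mpoly.
From mathcomp Require Import boolp classical_sets reals topology.

Set Implicit Arguments.
Unset Strict Implicit.
Unset Printing Implicit Defensive.

Import Order.TTheory GRing.Theory Num.Theory.
Import numFieldTopology.Exports.
Local Open Scope ring_scope.
Local Open Scope quotient_scope.

Section SimplicialComplexes.

(* Vertices are 0, ..., n - 1. A vertex i need not be a face: [set i] \in Delta
   is not required. *)
Record simplicial_complex (n : nat) := SimplicialComplex {
  faces :> {set {set 'I_n}};
  vertices_nonempty : (0 < n)%N;
  faces_nonempty : faces != finset.set0;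
  faces_closed : forall F G : {set 'I_n},
    F \in faces -> G \subset F -> G \in faces }.

Variables (n : nat) (Delta : simplicial_complex n).
Implicit Types F G e : {set 'I_n}.

Definition simplices (k : nat) : {set {set 'I_n}} :=
  [set F in (Delta : {set {set 'I_n}}) | #|F| == k.+1].

Definition facets : {set {set 'I_n}} :=
  [set F in (Delta : {set {set 'I_n}}) |
    [forall G in (Delta : {set {set 'I_n}}), (F \subset G) ==> (G == F)]].

Definition cofaces2 e : {set {set 'I_n}} :=
  [set F in simplices 2 | e \subset F].

Definition adjacent2 : rel {set 'I_n} :=
  fun F G => [&& F \in simplices 2, G \in simplices 2 &
                 finset.setI F G \in simplices 1].

Definition pseudomanifold2 : Prop :=
  [/\ forall F, F \in facets -> F \in simplices 2,
      forall e, e \in simplices 1 -> (1 <= #|cofaces2 e| <= 2)%N &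
      forall F G, F \in simplices 2 -> G \in simplices 2 ->
        connect adjacent2 F G].

Definition without_boundary : Prop :=
  ~ exists2 e, e \in simplices 1 & #|cofaces2 e| = 1%N.

Definition skeleton_faces (k : nat) : {set {set 'I_n}} :=
  [set F in (Delta : {set {set 'I_n}}) | (#|F| <= k.+1)%N].

Lemma skeleton_nonempty k : skeleton_faces k != finset.set0.
Proof.
have /set0Pn[F FD] := faces_nonempty Delta.
apply/set0Pn; exists finset.set0.
by rewrite inE cards0 leq0n andbT (faces_closed FD (finset.sub0set F)).
Qed.

Lemma skeleton_closed k F G :
  F \in skeleton_faces k -> G \subset F -> G \in skeleton_faces k.
Proof.
rewrite !inE => /andP[FD Fk] GF; rewrite (faces_closed FD GF) /=.
exact: leq_trans (subset_leq_card GF) Fk.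
Qed.

Definition skeleton (k : nat) : simplicial_complex n :=
  SimplicialComplex (vertices_nonempty Delta) (skeleton_nonempty k)
    (@skeleton_closed k).

End SimplicialComplexes.

(* A graph is a complex all of whose faces have at most two elements. *)
Notation graph_of Delta := (skeleton Delta 1).

Definition degree (n : nat) (G : simplicial_complex n) (i : 'I_n) : nat :=
  #|[set e in simplices G 1 | i \in e]|.

Definition eulerian (n : nat) (G : simplicial_complex n) : Prop :=
  forall i : 'I_n, [set i]%SET \in simplices G 0 -> ~~ odd (degree G i).

Section Topology.
Local Open Scope classical_set_scope.

Definition homeomorphic (X Y : topologicalType) : Prop :=
  exists (f : X -> Y) (g : Y -> X),
    [/\ continuous f, continuous g, cancel f g & cancel g f].

(* A set A is used as a type below: set_type A with the subspace topology. *)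
Definition topological_manifold (R : realType) (M : topologicalType) : Prop :=
  [/\ hausdorff_space M, @second_countable M &
      exists d : nat, forall x : M, exists (U : set M) (W : set 'rV[R]_d),
        [/\ open U, U x, open W & homeomorphic (set_type U) (set_type W)]].

(* Barycentric coordinates. *)
Definition geometric_realization (R : realType) (n : nat)
    (Delta : simplicial_complex n) : set 'rV[R]_n :=
  [set t | [/\ forall i, 0 <= t ord0 i, \sum_i t ord0 i = 1 &
               [set i | t ord0 i != 0]%SET \in (Delta : {set {set 'I_n}})]].

#[global] Arguments geometric_realization R [n] Delta.

Definition triangulation (R : realType) (n : nat)
    (Delta : simplicial_complex n) : Prop :=
  exists M : topologicalType, topological_manifold R M /\
    homeomorphic (set_type (geometric_realization R Delta)) M.

Definition planar_graph (R : realType) (n : nat)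
    (G : simplicial_complex n) : Prop :=
  exists P : set 'rV[R]_2,
    homeomorphic (set_type (geometric_realization R G)) (set_type P).

Definition planar_triangulation (R : realType) (n : nat)
    (Delta : simplicial_complex n) : Prop :=
  triangulation R Delta /\ planar_graph R (graph_of Delta).

End Topology.

Section GeneratedIdeal.
Variable S : comNzRingType.

Definition ideal_span (E : set S) : set S :=
  fun f => exists2 s : seq (S * S),
    (forall cg, cg \in s -> E cg.2) & f = \sum_(cg <- s) cg.1 * cg.2.

Lemma ideal_span0 E : ideal_span E 0.
Proof. by exists [::]; rewrite ?big_nil. Qed.

Lemma ideal_spanMD E a f g :
  ideal_span E f -> ideal_span E g -> ideal_span E (a * f + g).
Proof.
move=> [s sE ->] [t tE ->].
exists ([seq (a * cg.1, cg.2) | cg <- s] ++ t).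
  by move=> cg; rewrite mem_cat => /orP[/mapP[x /sE ? ->]|/tE].
rewrite big_cat big_map /= mulr_sumr; congr (_ + _).
by apply: eq_bigr => cg _; rewrite mulrA.
Qed.

Lemma ideal_span_sub (E F : set S) f :
  F 0 -> (forall a g h, F g -> F h -> F (a * g + h)) ->
  (forall g, E g -> F g) -> ideal_span E f -> F f.
Proof.
move=> F0 FMD EF [s sE ->]; elim: s sE => [|cg s IHs] sE.
  by rewrite big_nil.
rewrite big_cons; apply: FMD; first by apply/EF/sE; rewrite mem_head.
by apply: IHs => x xs; apply: sE; rewrite in_cons xs orbT.
Qed.

End GeneratedIdeal.

Section Algebra.
Variables (k : fieldType) (n : nat) (Delta : simplicial_complex n).

Definition stanley_reisner : set {mpoly k[n]} :=
  ideal_span (fun f => exists2 F : {set 'I_n},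
    F \notin (Delta : {set {set 'I_n}}) & f = \prod_(i in F) 'X_i).

Definition defining_ideal : set {mpoly k[n]} :=
  ideal_span (fun f =>
    (exists i : 'I_n, f = 'X_i ^+ 2) \/ stanley_reisner f).

Definition in_defining_ideal (f : {mpoly k[n]}) : bool :=
  `[< defining_ideal f >].

Lemma defining_ideal_const f : defining_ideal f -> f.@[fun=> 0] = 0.
Proof.
have FMD (a g h : {mpoly k[n]}) : g.@[fun=> 0] = 0 -> h.@[fun=> 0] = 0 ->
  (a * g + h).@[fun=> 0] = 0 by rewrite mevalD mevalM => -> ->; rewrite mulr0 addr0.
apply: (@ideal_span_sub _ _ (fun g => g.@[fun=> 0] = 0)) => //.
  exact: meval0.
move=> g [[i ->]|]; first by rewrite expr2 mevalM mevalXU mul0r.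
apply: (@ideal_span_sub _ _ (fun g => g.@[fun=> 0] = 0)) => //.
  exact: meval0.
move=> {}g [F FnD ->]; have [i iF] : exists i, i \in F.
  apply/set0Pn; apply: contraNneq FnD => ->.
  have /set0Pn[G GD] := faces_nonempty Delta.
  exact: faces_closed GD (finset.sub0set G).
by rewrite (bigD1 i) //= mevalM mevalXU mul0r.
Qed.

Lemma defining_ideal_closed : idealr_closed in_defining_ideal.
Proof.
split.
- exact/asboolP/ideal_span0.
- apply/negP => /asboolP/defining_ideal_const/eqP.
  by rewrite meval1 oner_eq0.
- by move=> a f g /asboolP fI /asboolP gI; apply/asboolP/ideal_spanMD.
Qed.

HB.instance Definition _ :=
  isIdealr.Build {mpoly k[n]} in_defining_ideal defining_ideal_closed.

Definition defining_idealr : idealr {mpoly k[n]} := in_defining_ideal.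

Definition sqfree_SR_algebra : comNzRingType := {ideal_quot defining_idealr}.

Definition residue (f : {mpoly k[n]}) : sqfree_SR_algebra :=
  \pi_({ideal_quot defining_idealr}) f.

Definition graded_piece (i : nat) : set sqfree_SR_algebra :=
  fun u => exists2 f : {mpoly k[n]}, f \is i.-homog & u = residue f.

Definition linear_form (a : 'I_n -> k) : {mpoly k[n]} :=
  \sum_(j < n) a j *: 'X_j.

Definition mult_injective (l : sqfree_SR_algebra) (i : nat) : Prop :=
  forall u v, graded_piece i u -> graded_piece i v -> l * u = l * v -> u = v.

Definition mult_surjective (l : sqfree_SR_algebra) (i : nat) : Prop :=
  forall w, graded_piece i.+1 w -> exists2 u, graded_piece i u & w = l * u.

Definition zariski_open (U : set ('I_n -> k)) : Prop :=
  exists E : set {mpoly k[n]},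
    forall a, U a <-> exists2 p, E p & p.@[a] != 0.

(* Linear forms are identified with their coefficient vectors; "general" means
   for all vectors in some non-empty Zariski open set. *)
Definition WLP_in_degree (i : nat) : Prop :=
  exists U : set ('I_n -> k),
    [/\ zariski_open U, exists a, U a &
        forall a, U a -> mult_injective (residue (linear_form a)) i \/
                         mult_surjective (residue (linear_form a)) i].

End Algebra.

(* Main.v *)
(* Since 2 f_1 = 3 f_2 there are more edges than triangles, so multiplication
   by a linear form is never injective in degree 2. If all coefficients of the
   form are nonzero, surjectivity is dual to the absence of a nonzero function
   on the triangles taking opposite values on any two triangles that share an
   edge, so it fails exactly when the triangles can be properly 2-coloured. In
   a 2-coloured complex every edge at a vertex v lies in one white triangle, and
   every white triangle at v has two edges at v, so the degree of v is even.

   Conversely, for a planar graph f_1 <= 3 f_0 - 6, which for a strongly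
   connected closed pseudomanifold forces the first homology over F_2 to vanish.
   If all degrees are even the sum of all edges is a cycle, so it bounds a chain
   of triangles, and this chain is one colour class of a 2-colouring.

   The edge bound follows Mader: a graph violating it has a K5 minor. A plane
   embedding of such a graph can be approximated by polygonal arcs in general
   position joining five points in such a way that arcs without a common
   endpoint are disjoint; but the number of crossings between such pairs of
   arcs is always odd. *)
Require Import Defs.
From mathcomp Require Import all_boot all_order all_algebra.
From mathcomp Require Import reals.
From mathcomp Require Import ring lra zify.

Set Implicit Arguments.
Unset Strict Implicit.
Unset Printing Implicit Defensive.

Import Order.TTheory GRing.Theory Num.Theory.

(** * Parity of crossings *)

Section OrderType.
Variables (I : eqType) (o : I -> I -> I -> bool).

(** With [o] read as an orientation predicate, the segments [x y] and [z w] cross: each line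
    separates the ends of the other segment. *)
Definition crossing x y z w :=
  (o x y z (+) o x y w) && (o z w x (+) o z w y).

Definition in_triangle a b c p := (o a b p == o b c p) && (o b c p == o c a p).

Fixpoint path_crossing x s p q :=
  if s is y :: s' then crossing x y p q (+) path_crossing y s' p q else false.

Fixpoint paths_crossing x s y t :=
  if t is z :: t' then path_crossing x s y z (+) paths_crossing x s z t'
  else false.

(** The winding number modulo 2 around [p] of the path closed up through [b], computed from the fan
    of triangles with apex [b]. *)
Fixpoint winding b x s p :=
  if s is y :: s' then in_triangle b x y p (+) winding b y s' p else false.

Hypothesis odegen : forall x y, o x x y = false.
Hypothesis orot : forall x y z, o y z x = o x y z.
Hypothesis oswap : forall x y z, uniq [:: x; y; z] -> o y x z = ~~ o x y z.
Hypothesis oaffine : forall a b c d, uniq [:: a; b; c; d] ->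
  (o a b d == o b c d) && (o b c d == o c a d) ==> (o a b c == o a b d).
(* Signs of the three-term Grassmann-Pluecker relation
   [abc][ade] - [abd][ace] + [abe][acd] = 0. *)
Hypothesis oGP : forall a b c d e, uniq [:: a; b; c; d; e] ->
  ((o a b c == o a d e) == (o a b e == o a c d)) ==>
  ((o a b c == o a d e) == (o a b d == o a c e)).

Lemma o_perm x y z : uniq [:: x; y; z] ->
  (o y z x = o x y z) * (o z x y = o x y z) * (o y x z = ~~ o x y z) *
  (o x z y = ~~ o x y z) * (o z y x = ~~ o x y z).
Proof.
move=> /oswap s; have r1 := orot x y z; have r2 := orot y z x.
have r3 := orot y x z; have r4 := orot x z y.
by rewrite r4 r3 r2 r1 s.
Qed.

Lemma crossingC x y z w : crossing x y z w = crossing z w x y.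
Proof. exact: andbC. Qed.

Lemma crossing_degen x z w : crossing x x z w = false.
Proof. by rewrite /crossing !odegen. Qed.

Lemma crossing_swap x y z w : uniq [:: x; y; z] -> uniq [:: x; y; w] ->
  crossing y x z w = crossing x y z w.
Proof.
move=> /oswap u /oswap v.
by rewrite /crossing u v addbN addNb negbK [X in _ && X]addbC.
Qed.

(* Verified on all sign vectors satisfying the relations [oaffine] and [oGP]. *)
Lemma five_points_parity a b c d e : uniq [:: a; b; c; d; e] ->
  (crossing a b d e (+) crossing b c d e (+) crossing c a d e ==
   in_triangle a b c d (+) in_triangle a b c e) &&
  (crossing a b c d (+) crossing a b c e (+) crossing a b d e (+)
   crossing a c b d (+) crossing a c b e (+) crossing a c d e (+)
   crossing a d b c (+) crossing a d b e (+) crossing a d c e (+)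
   crossing a e b c (+) crossing a e b d (+) crossing a e c d (+)
   crossing b c d e (+) crossing b d c e (+) crossing b e c d).
Proof.
move=> u; have sub m : uniq (mask m [:: a; b; c; d; e]).
  by rewrite mask_uniq.
have Pabc := o_perm (sub [:: true; true; true]).
have Pabd := o_perm (sub [:: true; true; false; true]).
have Pabe := o_perm (sub [:: true; true; false; false; true]).
have Pacd := o_perm (sub [:: true; false; true; true]).
have Pace := o_perm (sub [:: true; false; true; false; true]).
have Pade := o_perm (sub [:: true; false; false; true; true]).
have Pbcd := o_perm (sub [:: false; true; true; true]).
have Pbce := o_perm (sub [:: false; true; true; false; true]).
have Pbde := o_perm (sub [:: false; true; false; true; true]).
have Pcde := o_perm (sub [:: false; false; true; true; true]).
have := oaffine (sub [:: true; true; true; true]).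
have := oaffine (sub [:: true; true; true; false; true]).
have := oaffine (sub [:: true; true; false; true; true]).
have := oaffine (sub [:: true; false; true; true; true]).
have := oaffine (sub [:: false; true; true; true; true]).
have /oGP : uniq ([:: a] ++ [::] ++ [:: b; c; d; e]) by rewrite uniq_catCA.
have /oGP : uniq ([:: b] ++ [:: a] ++ [:: c; d; e]) by rewrite uniq_catCA.
have /oGP : uniq ([:: c] ++ [:: a; b] ++ [:: d; e]) by rewrite uniq_catCA.
have /oGP : uniq ([:: d] ++ [:: a; b; c] ++ [:: e]) by rewrite uniq_catCA.
have /oGP : uniq ([:: e] ++ [:: a; b; c; d] ++ [::]) by rewrite uniq_catCA.
rewrite /crossing /in_triangle /= ?Pabc ?Pabd ?Pabe ?Pacd ?Pace ?Pade.
rewrite ?Pbcd ?Pbce ?Pbde ?Pcde; clear.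
move: (o a b c) (o a b d) (o a b e) (o a c d) (o a c e) (o a d e).
move: (o b c d) (o b c e) (o b d e) (o c d e).
by do 10![case].
Qed.

Lemma crossing_flip x y p q : p \notin [:: x; y] -> q \notin [:: x; y] ->
  crossing y x p q = crossing x y p q.
Proof.
have [->//|xy] := eqVneq x y.
rewrite !inE !negb_or => /andP[px py] /andP[qx qy].
by apply: crossing_swap; rewrite /= !inE negb_or xy /= ![x == _]eq_sym
  ![y == _]eq_sym ?px ?py ?qx ?qy.
Qed.

(** Since [odegen] makes degenerate orientations [false], a constant triple contains every point,
    while for exactly two equal entries two of the orientations are opposite. The value does not
    depend on [p], which is what [triangle_crossing] needs. *)
Lemma in_triangle_degen a b c p : p \notin [:: a; b; c] ->
  ~~ uniq [:: a; b; c] -> in_triangle a b c p = (a == b) && (b == c).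
Proof.
have swap x y z : x != y -> z != x -> z != y -> o y x z = ~~ o x y z.
  move=> xy zx zy; apply: oswap.
  by rewrite /= !inE negb_or xy /= ![_ == z]eq_sym zx zy.
rewrite !inE !negb_or => /and3P[pa pb pc]; rewrite /in_triangle /= !inE.
have [->|ab] := eqVneq a b.
  have [->|bc] := eqVneq b c; first by rewrite !odegen.
  by rewrite !odegen (swap b c) //; case: (o _ _ _).
have [ebc|bc] := eqVneq b c.
  by move: ab pb; rewrite ebc => ac pc'; rewrite !odegen (swap a c) //;
    case: (o _ _ _).
have [->|//] := eqVneq a c.
by rewrite odegen (swap b c) //; case: (o _ _ _).
Qed.

(** For distinct points this is the first half of [five_points_parity]. For a degenerate triangle
    the sides cancel, and so do the two containment terms. *)
Lemma triangle_crossing a b c p q :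
    p \notin [:: a; b; c] -> q \notin [:: a; b; c] ->
  crossing a b p q (+) crossing b c p q (+) crossing c a p q =
  in_triangle a b c p (+) in_triangle a b c q.
Proof.
move=> pN qN; have [<-|pq] := eqVneq p q.
  by rewrite /crossing !addbb.
have [u|nu] := boolP (uniq [:: a; b; c]).
  suff /five_points_parity/andP[/eqP] : uniq ([:: a; b; c] ++ [:: p; q]) by [].
  rewrite cat_uniq u /=; apply/andP; split; last by rewrite /= inE pq.
  by apply/(@hasPn _ _ [:: p; q]) => z; rewrite !inE => /pred2P[]->.
rewrite !in_triangle_degen // addbb.
move: pN qN; rewrite !inE !negb_or => /and3P[pa pb pc] /and3P[qa qb qc].
move: nu; rewrite /= !inE.
have [->|ab] := eqVneq a b.
  by rewrite crossing_degen (@crossing_flip b c) ?inE ?negb_or ?pb ?qb ?addbb.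
have [->|bc] := eqVneq b c.
  by rewrite crossing_degen (@crossing_flip a c) ?inE ?negb_or ?pa ?qa ?addbF
    ?addbb.
have [->|//] := eqVneq a c.
by rewrite crossing_degen (@crossing_flip c b) ?inE ?negb_or ?pc ?qc ?addbF
  ?addbb.
Qed.

(** Summing [triangle_crossing] over the fan with apex [b] cancels all spokes but the first and the
    last. *)
Lemma path_crossing_winding b x s p q :
    p \notin [:: b, x & s] -> q \notin [:: b, x & s] ->
  path_crossing x s p q = crossing b x p q (+) crossing b (last x s) p q (+)
                          (winding b x s p (+) winding b x s q).
Proof.
elim: s x => [|y s IHs] x pN qN /=; first by rewrite addbb.
have sub z : z \notin [:: b, x, y & s] ->
    z \notin [:: b; x; y] /\ z \notin [:: b, y & s].
  rewrite !inE !negb_or => /and4P[-> -> -> zs].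
  by rewrite zs.
have [pT pS] := sub p pN; have [qT qS] := sub q qN.
have flip : crossing y b p q = crossing b y p q.
  move: pT qT; rewrite !inE !negb_or => /and3P[pb px py] /and3P[qb qx qy].
  by apply: crossing_flip; rewrite !inE negb_or ?pb ?qb.
rewrite IHs //; have := triangle_crossing pT qT; rewrite flip.
move: (crossing x y p q) (crossing b y p q) (crossing b x p q)
  (in_triangle b x y p) (in_triangle b x y q) (crossing b (last y s) p q)
  (winding b y s p) (winding b y s q).
by do 8![case].
Qed.

Lemma paths_crossingC x s y t :
  paths_crossing x s y t = paths_crossing y t x s.
Proof.
elim: t y => [|z t IHt] y /=; first by elim: s x => //= w s IHs x; rewrite -IHs.
rewrite IHt; elim: s x {IHt} => //= w s IHs x.
rewrite -IHs [crossing y z x w]crossingC.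
by rewrite addbACA.
Qed.

(** Taking the start [x] as apex makes the first spoke degenerate, so the path can be replaced by
    its chord; along [y :: t] the corrections telescope to the two ends. *)
Lemma paths_crossing_straight x s y t :
    {in y :: t, forall p, p \notin x :: s} ->
  paths_crossing x s y t = paths_crossing x [:: last x s] y t (+)
    (winding x x s y (+) winding x x s (last y t)).
Proof.
elim: t y => [|z t IHt] y dis; first by rewrite /= addbb.
have yN : y \notin x :: s by apply: dis; rewrite mem_head.
have {}dis : {in z :: t, forall p, p \notin x :: s}.
  by move=> p pt; apply: dis; rewrite inE pt orbT.
have zN : z \notin x :: s by apply: dis; rewrite mem_head.
rewrite [paths_crossing x s _ _]/= [paths_crossing x [:: _] _ _]/= IHt //.
rewrite (@path_crossing_winding x) ?inE ?orbA ?orbb -?in_cons // crossing_degen.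
rewrite [winding x x s (last y _)]/=.
move: (crossing _ _ _ _) (winding x x s y) (winding x x s z)
  (paths_crossing _ _ _ _) (winding x x s (last z t)).
by do 5![case].
Qed.

(** Both paths are replaced by their chords in turn, using [paths_crossingC] in between. *)
Lemma paths_crossingE x s y t : {in y :: t, forall p, p \notin x :: s} ->
  paths_crossing x s y t = crossing x (last x s) y (last y t) (+)
    (winding x x s y (+) winding x x s (last y t)) (+)
    (winding y y t x (+) winding y y t (last x s)).
Proof.
move=> dis; rewrite paths_crossing_straight // paths_crossingC.
rewrite paths_crossing_straight /=.
  rewrite !addbF [crossing y _ _ _]crossingC.
  by rewrite addbAC.
by move=> p; rewrite inE mem_seq1 => /pred2P[]->; apply/negP => /dis/negP;
  apply; rewrite ?mem_last ?mem_head.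
Qed.

(** Here [g i j k] stands for the winding of the arc [i j] around [k]. It occurs twice, in the pairs
    [i j | k l] for the two remaining choices of [l]. *)
Lemma addb_pairs_cancel (V : Type) (g : V -> V -> V -> bool) v0 v1 v2 v3 v4 :
  (g v0 v1 v2 (+) g v0 v1 v3 (+)
     (g v2 v3 v0 (+) g v2 v3 v1)) (+)
    (g v0 v1 v2 (+) g v0 v1 v4 (+)
     (g v2 v4 v0 (+) g v2 v4 v1)) (+)
    (g v0 v1 v3 (+) g v0 v1 v4 (+)
     (g v3 v4 v0 (+) g v3 v4 v1)) (+)
    (g v0 v2 v1 (+) g v0 v2 v3 (+)
     (g v1 v3 v0 (+) g v1 v3 v2)) (+)
    (g v0 v2 v1 (+) g v0 v2 v4 (+)
     (g v1 v4 v0 (+) g v1 v4 v2)) (+)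
    (g v0 v2 v3 (+) g v0 v2 v4 (+)
     (g v3 v4 v0 (+) g v3 v4 v2)) (+)
    (g v0 v3 v1 (+) g v0 v3 v2 (+)
     (g v1 v2 v0 (+) g v1 v2 v3)) (+)
    (g v0 v3 v1 (+) g v0 v3 v4 (+)
     (g v1 v4 v0 (+) g v1 v4 v3)) (+)
    (g v0 v3 v2 (+) g v0 v3 v4 (+)
     (g v2 v4 v0 (+) g v2 v4 v3)) (+)
    (g v0 v4 v1 (+) g v0 v4 v2 (+)
     (g v1 v2 v0 (+) g v1 v2 v4)) (+)
    (g v0 v4 v1 (+) g v0 v4 v3 (+)
     (g v1 v3 v0 (+) g v1 v3 v4)) (+)
    (g v0 v4 v2 (+) g v0 v4 v3 (+)
     (g v2 v3 v0 (+) g v2 v3 v4)) (+)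
    (g v1 v2 v3 (+) g v1 v2 v4 (+)
     (g v3 v4 v1 (+) g v3 v4 v2)) (+)
    (g v1 v3 v2 (+) g v1 v3 v4 (+)
     (g v2 v4 v1 (+) g v2 v4 v3)) (+)
    (g v1 v4 v2 (+) g v1 v4 v3 (+)
     (g v2 v3 v1 (+) g v2 v3 v4)) = false.
Proof.
move: (g v0 v1 v2)
  (g v0 v1 v3)
  (g v0 v1 v4)
  (g v0 v2 v1)
  (g v0 v2 v3)
  (g v0 v2 v4)
  (g v0 v3 v1)
  (g v0 v3 v2)
  (g v0 v3 v4)
  (g v0 v4 v1)
  (g v0 v4 v2)
  (g v0 v4 v3)
  (g v1 v2 v0)
  (g v1 v2 v3)
  (g v1 v2 v4)
  (g v1 v3 v0)
  (g v1 v3 v2)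
  (g v1 v3 v4)
  (g v1 v4 v0)
  (g v1 v4 v2)
  (g v1 v4 v3)
  (g v2 v3 v0)
  (g v2 v3 v1)
  (g v2 v3 v4)
  (g v2 v4 v0)
  (g v2 v4 v1)
  (g v2 v4 v3)
  (g v3 v4 v0)
  (g v3 v4 v1)
  (g v3 v4 v2).
move=> x1 x2 x3 x4 x5 x6 x7 x8 x9 x10 x11 x12 x13 x14 x15 x16 x17 x18 x19 x20 x21
  x22 x23 x24 x25 x26 x27 x28 x29 x30.
(* In the boolean ring exclusive or is addition, so [ring] can exhibit the sum as a double. *)
rewrite -[addb]/(@GRing.add bool).
transitivity ((x1 + x2 + x3 + x4 + x5 + x6 + x7 + x8 + x9 + x10 + x11 + x12 + x13 +
    x14 + x15 + x16 + x17 + x18 + x19 + x20 + x21 + x22 + x23 + x24 + x25 +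
    x26 + x27 + x28 + x29 + x30) *+ 2)%R; first by ring.
by rewrite mulr2n -[GRing.add]/addb addbb.
Qed.

(* The winding terms cancel in pairs, so that the parity is that of the
   straight-line drawing. *)
Lemma K5_paths_crossing (r : 'I_5 -> I) (w : 'I_5 -> 'I_5 -> seq I) :
    injective r ->
    (forall i j, i != j -> last (r i) (w i j) = r j) ->
    (forall i j k l, uniq [:: i; j; k; l] ->
       {in r k :: w k l, forall p, p \notin r i :: w i j}) ->
  ~ (forall i j k l, uniq [:: i; j; k; l] ->
       ~~ paths_crossing (r i) (w i j) (r k) (w k l)).
Proof.
move=> r_inj wlast wdis none.
pose g i j k := winding (r i) (r i) (w i j) (r k).
have E i j k l : uniq [:: i; j; k; l] -> crossing (r i) (r j) (r k) (r l) =
    (g i j k (+) g i j l) (+) (g k l i (+) g k l j).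
  move=> u; have /negbTE := none _ _ _ _ u.
  rewrite paths_crossingE; last exact: wdis.
  move: u => /= /and4P[]; rewrite !inE !negb_or => /and3P[ij _ _] _ kl _.
  rewrite !wlast // /g; move: (crossing _ _ _ _)
    (winding _ _ (w i j) (r k)) (winding _ _ (w i j) (r l))
    (winding _ _ (w k l) (r i)) (winding _ _ (w k l) (r j)).
  by do 5![case].
pose v m (lt : (m < 5)%N) := Ordinal lt.
(* A straight-line drawing of the complete graph on five points has an odd number of crossings
   between disjoint edges. *)
have /five_points_parity/andP[_] :
    uniq (map r [:: v 0 isT; v 1 isT; v 2 isT; v 3 isT; v 4 isT]).
  by rewrite map_inj_uniq.
by rewrite !E // addb_pairs_cancel.
Qed.

End OrderType.

(** * Orientations of points in the plane *)

Section PlanePoints.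
Local Open Scope ring_scope.
Variables (R : realFieldType) (I : eqType) (x y : I -> R).

Definition area a b c := (x b - x a) * (y c - y a) - (y b - y a) * (x c - x a).
Definition ccw a b c := 0 < area a b c.

Definition general_position :=
  forall a b c, uniq [:: a; b; c] -> area a b c != 0.

Lemma ccw_degen a b : ccw a a b = false.
Proof. by rewrite /ccw /area !subrr !mul0r subrr ltxx. Qed.

Lemma ccw_rot a b c : ccw b c a = ccw a b c.
Proof. by rewrite /ccw; congr (_ < _); rewrite /area; ring. Qed.

Hypothesis generic : general_position.

Lemma ccwN a b c : uniq [:: a; b; c] -> ~~ ccw a b c = (area a b c < 0).
Proof. by move/generic=> nz; rewrite -leNgt le_eqVlt (negPf nz). Qed.

Lemma ccw_swap a b c : uniq [:: a; b; c] -> ccw b a c = ~~ ccw a b c.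
Proof.
move=> u; rewrite ccwN // /ccw.
have -> : area b a c = - area a b c by rewrite /area; ring.
by rewrite oppr_gt0.
Qed.

Variant ccw_spec a b c : bool -> Type :=
  | CCW of 0 < area a b c : ccw_spec a b c true
  | CW of area a b c < 0 : ccw_spec a b c false.

Lemma ccwP a b c : uniq [:: a; b; c] -> ccw_spec a b c (ccw a b c).
Proof.
move=> u; case: (boolP (ccw a b c)) => [|nu]; first by constructor.
by constructor; rewrite -ccwN.
Qed.

(** The signed area of [a b c] is the sum of those of the triangles joining [d] to its sides, so it
    has their sign if they agree. *)
Lemma ccw_affine a b c d : uniq [:: a; b; c; d] ->
  (ccw a b d == ccw b c d) && (ccw b c d == ccw c a d) ==>
  (ccw a b c == ccw a b d).
Proof.
move=> u; have v m : uniq (mask m [:: a; b; c; d]) by rewrite mask_uniq.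
have u1 := v [:: true; true; true]; have u2 := v [:: true; true; false; true].
have u3 := v [:: false; true; true; true].
have u4 : uniq [:: c; a; d].
  by have := v [:: true; false; true; true]; rewrite (uniq_catCA [:: a] [:: c]).
have e : area a b c = area a b d + area b c d + area c a d.
  by rewrite /area; ring.
by case: (ccwP u1); case: (ccwP u2); case: (ccwP u3); case: (ccwP u4) => //;
  rewrite e; lra.
Qed.

(** In [[abc][ade] + [abe][acd] = [abd][ace]], two summands of equal sign determine the sign of the
    right-hand side. *)
Lemma ccw_GP a b c d e : uniq [:: a; b; c; d; e] ->
  ((ccw a b c == ccw a d e) == (ccw a b e == ccw a c d)) ==>
  ((ccw a b c == ccw a d e) == (ccw a b d == ccw a c e)).
Proof.
move=> u; have v m : uniq (mask m [:: a; b; c; d; e]) by rewrite mask_uniq.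
have u1 := v [:: true; true; true]; have u2 := v [:: true; true; false; true].
have u3 := v [:: true; true; false; false; true].
have u4 := v [:: true; false; true; true].
have u5 := v [:: true; false; true; false; true].
have u6 := v [:: true; false; false; true; true].
have E : area a b c * area a d e + area a b e * area a c d =
         area a b d * area a c e by rewrite /area; ring.
case: (ccwP u1) => h1; case: (ccwP u6) => h6;
case: (ccwP u3) => h3; case: (ccwP u4) => h4 //=;
case: (ccwP u2) => h2; case: (ccwP u5) => h5 //=; exfalso; move: E; nra.
Qed.

(** The segments share a point; passing through it, one gets from [a] to [c] along a part of each
    segment. *)
Lemma crossing_dist a b c d : crossing ccw a b c d ->
    uniq [:: a; b; c; d] ->
  `|x a - x c| <= `|x a - x b| + `|x c - x d| /\
  `|y a - y c| <= `|y a - y b| + `|y c - y d|.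
Proof.
move=> cr u; have v m : uniq (mask m [:: a; b; c; d]) by rewrite mask_uniq.
have u1 := v [:: true; true; true]; have u2 := v [:: true; true; false; true].
have u3 : uniq [:: c; d; a].
  by have := v [:: true; false; true; true]; rewrite (uniq_catC [:: a]).
have u4 : uniq [:: c; d; b].
  by have := v [:: false; true; true; true]; rewrite (uniq_catC [:: b]).
have [s [t [s01 t01 ex ey]]] : exists s t, [/\ 0 <= s <= 1, 0 <= t <= 1,
   x a + s * (x b - x a) = x c + t * (x d - x c) &
   y a + s * (y b - y a) = y c + t * (y d - y c)].
  (* Cramer's rule: [D] is the determinant of the two directions, non-zero because [a] and [b] lie
     on opposite sides of the line [c d]. *)
  pose D := area c d a - area c d b.
  have D' : area a b c - area a b d = - D by rewrite /D /area; ring.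
  exists (area c d a / D), (- area a b c / D).
  have Dn0 : D != 0.
    by move: cr; rewrite /crossing /D; case: (ccwP u3); case: (ccwP u4) => h h';
      rewrite ?andbF // => _; lra.
  have cross p N w : (p + N / D * w) * D = p * D + N * w by field.
  split.
  - move: cr; rewrite /crossing => /andP[_]; rewrite /D in Dn0 *.
    case: (ccwP u3); case: (ccwP u4) => // h h' _.
      by rewrite ler_pdivlMr ?ler_pdivrMr; lra.
    by rewrite ler_ndivlMr ?ler_ndivrMr; lra.
  - move: cr; rewrite /crossing => /andP[+ _].
    case: (ccwP u1); case: (ccwP u2) => // h h' _.
      by rewrite ler_ndivlMr ?ler_ndivrMr; lra.
    by rewrite ler_pdivlMr ?ler_pdivrMr; lra.
  - apply: (mulIf Dn0); rewrite cross // cross //.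
    by rewrite /D /area; ring.
  - apply: (mulIf Dn0); rewrite cross // cross //.
    by rewrite /D /area; ring.
have bound p q r w : p + s * (q - p) = r + t * (w - r) ->
    `|p - r| <= `|p - q| + `|r - w|.
  move=> e; have -> : p - r = s * (p - q) - t * (r - w) by lra.
  apply: (le_trans (ler_normB _ _)); rewrite !normrM.
  by apply: lerD; apply: ler_piMl; rewrite ?normr_ge0 //; case/andP: s01 t01
    => s0 s1 /andP[t0 t1]; rewrite ger0_norm.
by split; apply: bound.
Qed.

End PlanePoints.

(** * Perturbation into general position *)

Section Perturbation.
Local Open Scope ring_scope.
Variable R : realFieldType.

(** The values [d / 2], [d / 3], ... lie in the interval, and [size p] of them cannot all be
    roots. *)
Lemma exists_nonroot (p : {poly R}) (d : R) : p != 0 -> 0 < d ->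
  exists2 h, 0 < h < d & p.[h] != 0.
Proof.
move=> p0 d0; pose s := [seq d / j.+2%:R | j <- iota 0 (size p)].
have us : uniq s.
  rewrite map_inj_uniq ?iota_uniq // => i j.
  by move/(mulfI (lt0r_neq0 d0))/invr_inj/eqP; rewrite eqr_nat => /eqP[].
have /allPn[h /mapP[j _ ->] nr] : ~~ all (root p) s.
  by apply/negP => /(max_poly_roots p0)/(_ us); rewrite size_map size_iota ltnn.
exists (d / j.+2%:R) => //; rewrite divr_gt0 //= ltr_pdivrMr // ltr_pMr //.
by rewrite ltr1n.
Qed.

(** The points are shifted by multiples [h] of distinct points [(t, t^2)] of a parabola. Each area
    becomes a quadratic polynomial in [h] whose leading coefficient is a Vandermonde determinant,
    hence non-zero, and some small [h] avoids the roots of all of them. *)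
Lemma general_position_approx (I : finType) (x y : I -> R) (d : R) : 0 < d ->
  exists x' y' : I -> R, [/\ forall i, `|x' i - x i| < d,
    forall i, `|y' i - y i| < d & general_position x' y'].
Proof.
move=> d0; pose t (i : I) : R := (enum_rank i)%:R.
pose c0 a b c := area x y a b c.
pose c1 a b c := area x (fun i => t i ^+ 2) a b c + area t y a b c.
pose c2 a b c := area t (fun i => t i ^+ 2) a b c.
have areaE h a b c : area (fun i => x i + h * t i) (fun i => y i + h * t i ^+ 2)
    a b c = (Poly [:: c0 a b c; c1 a b c; c2 a b c]).[h].
  by rewrite horner_Poly /= /c0 /c1 /c2 /area; ring.
have c2_neq0 a b c : uniq [:: a; b; c] -> c2 a b c != 0.
  have tinj : injective t.
    by move=> i j /eqP; rewrite eqr_nat => /eqP /val_inj /enum_rank_inj.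
  rewrite /= !inE negb_or => /and3P[/andP[ab ac] bc _].
  have -> : c2 a b c = (t b - t a) * (t c - t a) * (t c - t b).
    by rewrite /c2 /area; ring.
  by rewrite !mulf_neq0 // subr_eq0 (inj_eq tinj) eq_sym.
pose P := \prod_(u : I * I * I | uniq [:: u.1.1; u.1.2; u.2])
  Poly [:: c0 u.1.1 u.1.2 u.2; c1 u.1.1 u.1.2 u.2; c2 u.1.1 u.1.2 u.2].
have P0 : P != 0.
  apply/prodf_neq0 => u /c2_neq0 nz; apply: contra nz => /eqP e.
  have := coef_Poly
    [:: c0 u.1.1 u.1.2 u.2; c1 u.1.1 u.1.2 u.2; c2 u.1.1 u.1.2 u.2] 2.
  by rewrite e coef0 => /= <-.
(* [M] exceeds all [t i] and all [t i ^+ 2], so that [h < d / M] keeps every displacement below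
   [d]. *)
pose M : R := (#|I| ^ 2).+1%:R.
have M0 : 0 < M by rewrite ltr0n.
have [h /andP[h0 hd] Ph] := exists_nonroot P0 (divr_gt0 d0 M0).
have bound (m : nat) : (m <= #|I| ^ 2)%N -> `|h * m%:R| < d.
  move=> mI; rewrite normrM !ger0_norm ?(ltW h0) //.
  apply: le_lt_trans (_ : h * M < d); last by rewrite -ltr_pdivlMr.
  by rewrite ler_pM2l // ler_nat leqW.
exists (fun i => x i + h * t i), (fun i => y i + h * t i ^+ 2); split.
- move=> i; rewrite addrC addKr; apply: bound.
  have := ltn_ord (enum_rank i); move: (nat_of_ord _) => m.
  by case: #|I| => // k; nia.
- move=> i; rewrite addrC addKr -natrX; apply: bound.
  by rewrite leq_exp2r // ltnW.
- move=> a b c u; rewrite areaE; apply: contra Ph => /eqP e.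
  by rewrite horner_prod (bigD1 (a, b, c)) //= e mul0r.
Qed.

End Perturbation.

(** * Complete minors on five vertices *)

Section Mader.
Variable T : finType.
Implicit Types (V U B : {set T}) (r : rel T) (u v w x y : T).

Definition induced r U : rel T := fun x y => [&& x \in U, y \in U & r x y].

Definition connected_in r U :=
  forall x y, x \in U -> y \in U -> connect (induced r U) x y.

(* Branch sets of a complete minor on five vertices; as they are disjoint and
   nonempty, connectedness of the unions B i :|: B j is all that is needed of
   the connectedness of the B i and of the edges between them. *)
Definition K5_minor r := exists B : 'I_5 -> {set T},
  [/\ forall i, B i != set0,
      forall i j, i != j -> [disjoint B i & B j] &
      forall i j, i != j -> connected_in r (B i :|: B j)].

Definition neighbours r v := [set w | r v w].
Definition darts r := [set p : T * T | r p.1 p.2].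

Lemma K5_minor_sub r r' : subrel r r' -> K5_minor r -> K5_minor r'.
Proof.
move=> rr' [B [B0 Bd Bc]]; exists B; split=> // i j ij x y xU yU.
apply: connect_sub (Bc i j ij x y xU yU) => a b /and3P[aU bU /rr' rab].
by apply: connect1; apply/and3P.
Qed.

Lemma K5_minor_clique r (Q : {set T}) : #|Q| = 5 ->
  {in Q &, forall x y, x != y -> r x y} -> K5_minor r.
Proof.
move=> Q5 clq; pose q (i : 'I_5) := enum_val (cast_ord (esym Q5) i).
have qQ i : q i \in Q by apply: enum_valP.
have qinj : injective q by move=> i j /enum_val_inj/cast_ord_inj.
exists (fun i => [set q i]); split=> [i|i j ij|i j ij x y xU yU].
- by apply/set0Pn; exists (q i); rewrite inE.
- by rewrite disjoints1 inE (inj_eq qinj).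
- have [->|xy] := eqVneq x y; first exact: connect0.
  apply: connect1; apply/and3P; split=> //; apply: clq => //.
    by move: xU; rewrite !inE => /pred2P[]->.
  by move: yU; rewrite !inE => /pred2P[]->.
Qed.

(** [y] is merged into [x] but stays in the type as an isolated vertex. *)
Definition contract r x y : rel T := fun u w =>
  [&& u != w, u != y, w != y &
      [|| r u w, (u == x) && r y w | (w == x) && r u y]].

(** After contraction [y] is isolated, so it lies in no branch set. Adding it to the branch set that
    contains [x], if there is one, replaces each edge inherited from [y] by a path through [y]. *)
Lemma K5_minor_contract r x y : symmetric r -> r x y ->
  K5_minor (contract r x y) -> K5_minor r.
Proof.
move=> rs rxy [B [B0 Bd Bc]].
have yB i : y \notin B i.
  apply/negP => yBi; have [j ji] : exists j, i != j.
    by exists (if i == ord0 then ord_max else ord0); case: (eqVneq i ord0) => [->|].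
  have [z zB] := set0Pn _ (B0 j).
  have zy : z != y by apply: contraL yBi => /eqP<-; rewrite (disjointFl (Bd _ _ ji)).
  have /connectP[[|a p]] := Bc i j ji y z (subsetP (subsetUl _ _) _ yBi)
    (subsetP (subsetUr _ _) _ zB).
    by move=> _ /= e; rewrite e eqxx in zy.
  by rewrite /= /induced /contract eqxx !andbF.
pose B' i := if x \in B i then y |: B i else B i.
have BB' i : B i \subset B' i by rewrite /B'; case: ifP; rewrite ?subsetUr.
exists B'; split=> [i|i j ij|i j ij].
- have [z zB] := set0Pn _ (B0 i).
  by apply/set0Pn; exists z; apply: (subsetP (BB' i)).
- rewrite /B'; have d := Bd _ _ ij.
  case: ifP => xi; case: ifP => xj //.
  + by rewrite (disjointFr d xi) in xj.
  + by rewrite disjoints_subset subUset sub1set inE yB -disjoints_subset.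
  + by rewrite disjoint_sym disjoints_subset subUset sub1set inE yB
      -disjoints_subset disjoint_sym.
have UU' : B i :|: B j \subset B' i :|: B' j by apply: setUSS.
have U'E z : z \in B' i :|: B' j ->
    z \in B i :|: B j \/ z = y /\ x \in B i :|: B j.
  have B'E k : z \in B' k -> z \in B k \/ z = y /\ x \in B k.
    by rewrite /B'; case: ifP => xk; [rewrite inE => /orP[/set1P|]|]; auto.
  by rewrite !inE => /orP[]/B'E[->|[-> ->]]; rewrite ?orbT; auto.
have yU' : x \in B i :|: B j -> y \in B' i :|: B' j.
  by rewrite !inE /B' => /orP[]->; rewrite !inE eqxx ?orbT.
set W := induced r (B' i :|: B' j).
have Ws : connect_sym W.
  by apply: sym_connect_sym => a b; rewrite /W /induced rs andbCA.
have Wxy : x \in B i :|: B j -> connect W x y.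
  by move=> xU; apply: connect1; rewrite /W /induced (subsetP UU') ?yU' ?rxy.
have conn a b : a \in B i :|: B j -> b \in B i :|: B j -> connect W a b.
  move=> aU bU; apply: connect_sub (Bc i j ij a b aU bU) => {aU bU} {}a {}b.
  case/and3P=> aU bU /and4P[_ _ _].
  case/or3P=> [rab|/andP[/eqP ax rb]|/andP[/eqP bx ra]].
  - by apply: connect1; rewrite /W /induced !(subsetP UU').
  - rewrite ax in aU *; apply: connect_trans (Wxy aU) _; apply: connect1.
    by rewrite /W /induced yU' // (subsetP UU').
  - rewrite bx in bU *; rewrite Ws; apply: connect_trans (Wxy bU) _.
    by apply: connect1; rewrite /W /induced yU' // (subsetP UU') //= rs.
move=> a b /U'E aE /U'E bE.
case: aE => [aU|[-> xU]]; case: bE => [bU|[-> xU']].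
- exact: conn.
- by apply: connect_trans (Wxy xU'); apply: conn.
- by rewrite Ws; apply: connect_trans (Wxy xU); apply: conn.
- exact: connect0.
Qed.

Lemma card_darts r : #|darts r| = \sum_v #|neighbours r v|.
Proof.
rewrite -sum1_card (eq_bigl (fun p : T * T => r p.1 p.2)); last first.
  by move=> p; rewrite inE.
rewrite -(pair_big_dep xpredT r (fun _ _ => 1)) /=.
by apply: eq_bigr => v _; rewrite sum1dep_card.
Qed.

(** Besides the edge [x y], only one of the two edges at each common neighbour is lost, and every
    edge counts for two darts. The edges from [y] to [D] reappear at [x]. *)
Lemma card_darts_contract r x y : symmetric r -> irreflexive r -> r x y ->
  #|darts r| <= #|darts (contract r x y)| +
    (#|neighbours r x :&: neighbours r y| + 1) * 2.
Proof.
move=> rs ri rxy.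
pose D := neighbours r y :\: (x |: neighbours r x).
pose P0 := [set p in darts r | (p.1 != y) && (p.2 != y)].
have xNy : x != y by apply: contraTneq rxy => ->; rewrite ri.
have degy : #|neighbours r y| = #|neighbours r x :&: neighbours r y| + 1 + #|D|.
  rewrite -(cardsID (x |: neighbours r x) (neighbours r y)); congr (_ + _).
  rewrite setIUr setIC [_ :&: neighbours r x]setIC.
  have -> : [set x] :&: neighbours r y = [set x].
    by apply/setIidPl; rewrite sub1set inE rs.
  by rewrite cardsU1 inE negb_and inE ri addnC.
have up : #|darts r| <= #|P0| + #|neighbours r y| * 2.
  have sub : darts r \subset P0 :|: (setX [set y] (neighbours r y) :|:
      setX (neighbours r y) [set y]).
    apply/subsetP => -[a b]; rewrite !inE /= => rab; rewrite rab /=.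
    have [e|_] /= := eqVneq a y; first by rewrite -e rab.
    by have [e|] //= := eqVneq b y; rewrite -e rs rab.
  apply: leq_trans (subset_leq_card sub) _.
  apply: leq_trans (leq_card_setU _ _) _; rewrite leq_add2l.
  by apply: leq_trans (leq_card_setU _ _) _; rewrite !cardsX !cards1; lia.
have low : #|P0| + #|D| * 2 <= #|darts (contract r x y)|.
  have sub : P0 :|: (setX [set x] D :|: setX D [set x]) \subset
      darts (contract r x y).
    apply/subsetP => -[a b]; rewrite !inE /contract /= => /orP[|/orP[]].
    - case/and3P=> rab -> ->; rewrite rab !andbT.
      by apply: contraTneq rab => ->; rewrite ri.
    - case/andP=> /eqP->; rewrite negb_or => /andP[/andP[bx rxb] ryb].
      rewrite eq_sym bx xNy ryb eqxx orbT !andbT /=.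
      by apply: contraTneq ryb => ->; rewrite ri.
    - case/andP=> + /eqP->; rewrite negb_or => /andP[/andP[ax rxa] rya].
      rewrite ax xNy eqxx [r a y]rs rya !orbT !andbT /=.
      by apply: contraTneq rya => ->; rewrite ri.
  apply: leq_trans (subset_leq_card sub).
  have dXX : [disjoint setX [set x] D & setX D [set x]].
    rewrite -setI_eq0; apply/eqP/setP => -[a b]; rewrite !inE /=.
    by case: (eqVneq a x); rewrite /= ?andbF.
  have dP : [disjoint P0 & setX [set x] D :|: setX D [set x]].
    rewrite -setI_eq0; apply/eqP/setP => -[a b]; rewrite !inE /=.
    apply/negP => /andP[/and3P[rab _ _] /orP[]].
      by case/andP=> /eqP ax; rewrite -ax rab orbT.
    by case/andP=> + /eqP bx; rewrite -bx [r b a]rs rab orbT.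
  rewrite cardsU disjoint_setI0 // cards0 subn0.
  rewrite cardsU disjoint_setI0 // cards0 subn0 !cardsX !cards1; lia.
move: up low; rewrite degy; lia.
Qed.

Definition remove_vertex r v : rel T := fun u w => [&& u != v, w != v & r u w].

Lemma card_darts_remove_vertex r v : symmetric r ->
  #|darts r| <= #|darts (remove_vertex r v)| + #|neighbours r v| * 2.
Proof.
move=> rs.
have sub : darts r \subset darts (remove_vertex r v) :|:
    (setX [set v] (neighbours r v) :|: setX (neighbours r v) [set v]).
  apply/subsetP => -[a b]; rewrite !inE /remove_vertex /= => rab; rewrite rab.
  have [e|_] /= := eqVneq a v; first by rewrite -e rab.
  by have [e|] //= := eqVneq b v; rewrite -e rs rab.
apply: leq_trans (subset_leq_card sub) _.
apply: leq_trans (leq_card_setU _ _) _; rewrite leq_add2l.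
by apply: leq_trans (leq_card_setU _ _) _; rewrite !cardsX !cards1; lia.
Qed.

Definition remove_edge r x y : rel T := fun u w =>
  [&& (u, w) != (x, y), (u, w) != (y, x) & r u w].

Lemma card_darts_remove_edge r x y : r x y ->
  #|darts r| <= #|darts (remove_edge r x y)| + 2 /\
  #|darts (remove_edge r x y)| < #|darts r|.
Proof.
move=> rxy; split.
  have sub : darts r \subset darts (remove_edge r x y) :|: [set (x, y); (y, x)].
    apply/subsetP => -[a b]; rewrite !inE /remove_edge /= => ->.
    by do 2![case: eqP].
  apply: leq_trans (subset_leq_card sub) _.
  by apply: leq_trans (leq_card_setU _ _) _; rewrite leq_add2l cards2; case: eqP.
apply: proper_card; apply/properP; split.
  by apply/subsetP => -[a b]; rewrite !inE /= => /and3P[].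
by exists (x, y); rewrite !inE ?rxy // /remove_edge eqxx.
Qed.


Definition supported_on V r := forall x y, r x y -> x \in V /\ y \in V.

(* In a counterexample of minimal size every edge has at least three common
   neighbours and some vertex v has degree at most five, so the neighbourhood
   of v is a K4 or becomes one after contracting a suitable edge. *)
Lemma dense_neighbourhood_K5 r v : symmetric r -> irreflexive r ->
    3 < #|neighbours r v| <= 5 ->
    {in neighbours r v, forall u, 2 < #|neighbours r v :&: neighbours r u|} ->
  K5_minor r.
Proof.
move=> rs ri /andP[N4 N5] com; set N := neighbours r v in N4 N5 com.
have vN : v \notin N by rewrite inE ri.
(* [S] avoids the at least three common neighbours of [v] and [u]; as [u] belongs to [S], this
   bounds the number of its non-neighbours in [N]. *)
have few u (S : {set T}) : u \in N -> S \subset N -> u \in S ->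
    {in S, forall w, ~~ r u w} -> #|S| + 3 <= #|N|.
  move=> uN SN uS Sr; have d : [disjoint S & N :&: neighbours r u].
    rewrite -setI_eq0; apply/eqP/setP => w; rewrite !inE.
    by apply/negP => /and3P[/Sr/negPf->].
  apply: leq_trans (_ : #|S :|: N :&: neighbours r u| <= _).
    by rewrite cardsU (disjoint_setI0 d) cards0 subn0 leq_add2l com.
  by rewrite subset_leq_card // subUset SN subsetIl.
have [N4'|N5'] : #|N| = 4 \/ #|N| = 5 by lia.
  have clq : {in N &, forall x y, x != y -> r x y}.
    move=> x y xN yN xy; apply: contraT => nr.
    have := few x [set x; y] xN; rewrite subUset !sub1set xN yN !inE eqxx.
    move=> /(_ isT isT); rewrite cards2 xy N4'.
    suff h : {in [set x; y], forall z, ~~ r x z} by move/(_ h).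
    by move=> z; rewrite !inE => /pred2P[]->; rewrite ?ri.
  apply: (@K5_minor_clique _ (v |: N)); first by rewrite cardsU1 vN N4'.
  move=> x y /setU1P[->|xN] /setU1P[->|yN]; rewrite ?eqxx //.
  - by move: yN; rewrite inE.
  - by move: xN; rewrite inE rs.
  - exact: clq.
(* Among five neighbours the missing edges form a matching. *)
have uniq_non u w w' : u \in N -> w \in N -> w' \in N -> u != w -> u != w' ->
    ~~ r u w -> ~~ r u w' -> w = w'.
  move=> uN wN w'N uw uw' nw nw'; apply/eqP; apply: contraT => ww'.
  have := few u [set u; w; w'] uN; rewrite !subUset !sub1set uN wN w'N !inE eqxx.
  move=> /(_ isT isT); rewrite N5' -setUA cardsU1 !inE negb_or uw uw' cards2 ww'.
  suff h : {in u |: [set w; w'], forall z, ~~ r u z} by move/(_ h).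
  by move=> z; rewrite !inE => /or3P[]/eqP->; rewrite ?ri.
(* If [a c] is missing, let [b] be an end of the other missing edge, if there is one. Contracting
   [a b] creates the edge [a c], since [b] is adjacent to [c], and the other missing edge disappears
   with [b]. *)
have [a [b [aN bN rab clq]]] : exists a b, [/\ a \in N, b \in N, r a b &
    {in N :\ b &, forall x y, x != y -> contract r a b x y}].
  have cE a b x y : x \in N :\ b -> y \in N :\ b -> x != y ->
     (r x y || ((x == a) && r b y)) || ((y == a) && r b x) -> contract r a b x y.
    rewrite !in_setD1 /contract => /andP[-> _] /andP[-> _] ->.
    by rewrite [r x b]rs -orbA.
  have [all_adj|] := boolP [forall x in N, forall y in N, (x != y) ==> r x y].
    have [a aN] : exists a, a \in N by apply/set0Pn; rewrite -card_gt0; lia.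
    have [b] : exists b, b \in N :\ a.
      by apply/set0Pn; rewrite -card_gt0; move: (cardsD1 a N); rewrite aN; lia.
    rewrite in_setD1 => /andP[ba bN].
    have adj x y : x \in N -> y \in N -> x != y -> r x y.
      move=> xN yN.
      by move/forall_inP: all_adj => /(_ x xN)/forall_inP/(_ y yN)/implyP.
    exists a, b; split; rewrite // ?adj 1?eq_sym // => x y xN yN xy.
    apply: cE => //; rewrite adj //.
      by move: xN; rewrite in_setD1 => /andP[].
    by move: yN; rewrite in_setD1 => /andP[].
  case/forall_inPn => a aN /forall_inPn[c cN].
  rewrite negb_imply => /andP[ac nac].
  pose M := N :\ a :\ c.
  have cM : #|M| = 3.
    have := cardsD1 c (N :\ a); have := cardsD1 a N.
    by rewrite aN in_setD1 [c == a]eq_sym ac cN -/M; lia.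
  have MN x : x \in M -> [/\ x != c, x != a & x \in N].
    by rewrite !in_setD1 => /and3P[].
  have [b [bM bclq]] : exists b, b \in M /\
      {in M :\ b &, forall x y, x != y -> r x y}.
    have [all_adj|] := boolP [forall x in M, forall y in M, (x != y) ==> r x y].
      have [b bM] : exists a, a \in M by apply/set0Pn; rewrite -card_gt0 cM.
      exists b; split=> // x y /setD1P[_ xM] /setD1P[_ yM].
      by move/forall_inP: all_adj => /(_ x xM)/forall_inP/(_ y yM)/implyP.
    case/forall_inPn => b bM /forall_inPn[d dM].
    rewrite negb_imply => /andP[bd nbd].
    exists b; split=> // x y /setD1P[xb xM] /setD1P[yb yM] xy.
    apply: contraT => nxy.
    have xd : x != d.
      apply: contraNneq yb => xd; apply/eqP; rewrite xd in xy nxy.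
      have [_ _ ?] := MN _ bM; have [_ _ ?] := MN _ dM; have [_ _ ?] := MN _ yM.
      by apply: (uniq_non d); rewrite // 1?rs // eq_sym.
    have yd : y != d.
      apply: contraNneq xb => yd; apply/eqP; rewrite yd in xy nxy.
      have [_ _ ?] := MN _ bM; have [_ _ ?] := MN _ dM; have [_ _ ?] := MN _ xM.
      by apply: (uniq_non d); rewrite // 1?rs // eq_sym.
    have sub : [set b; d; x; y] \subset M by rewrite !subUset !sub1set bM dM xM yM.
    have := subset_leq_card sub; rewrite cM -!setUA !cardsU1 cards1 !inE !negb_or.
    by rewrite bd [b == x]eq_sym xb [b == y]eq_sym yb [d == x]eq_sym xd
      [d == y]eq_sym yd xy.
  have [bc ba bN] := MN b bM.
  have rab : r a b.
    apply: contraT => nab; move: bc; rewrite eq_sym => /eqP[].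
    by apply: (uniq_non a) => //; rewrite eq_sym.
  have rc w : w \in N -> w != a -> w != c -> r c w.
    move=> wN wa wc; apply: contraT => ncw; move: wa; rewrite eq_sym => /eqP[].
    by apply: (uniq_non c) => //; rewrite 1?rs // eq_sym.
  have ra w : w \in N -> w != a -> w != c -> r a w.
    move=> wN wa wc; apply: contraT => naw; move: wc; rewrite eq_sym => /eqP[].
    by apply: (uniq_non a) => //; rewrite eq_sym.
  exists a, b; split=> // x y xNb yNb xy; apply: cE => //.
  move: xNb yNb; rewrite !in_setD1 => /andP[xb xN] /andP[yb yN].
  have [xa|xa] := eqVneq x a; have [ya|ya] := eqVneq y a.
  - by rewrite xa ya eqxx in xy.
  - have [->|yc] := eqVneq y c; first by rewrite [r b c]rs (rc b) ?orbT.
    by rewrite xa ra.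
  - have [->|xc] := eqVneq x c; first by rewrite [r b c]rs (rc b) ?orbT.
    by rewrite ya rs ra.
  - have [xc|xc] := eqVneq x c.
      by rewrite xc rc // -xc eq_sym.
    have [yc|yc] := eqVneq y c; first by rewrite yc rs rc.
    by rewrite bclq // !in_setD1 ?xb ?yb ?xa ?ya ?xc ?yc.
apply: (K5_minor_contract rs rab); apply: (@K5_minor_clique _ (v |: N :\ b)).
  have vNb : v \notin N :\ b by rewrite in_setD1 (negPf vN) andbF.
  by have := cardsD1 b N; rewrite bN cardsU1 vNb; lia.
have vb : v != b by apply: contraNneq vN => ->.
have rv x : x \in N -> r v x by rewrite inE.
move=> x y /setU1P[->|xN] /setU1P[->|yN]; rewrite ?eqxx //.
- move=> vy; move: yN; rewrite in_setD1 => /andP[yb yN].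
  by rewrite /contract vy vb yb rv.
- move=> xv; move: xN; rewrite in_setD1 => /andP[xb xN].
  by rewrite /contract xv vb xb rs rv.
- exact: clq.
Qed.

(** In terms of edges the density hypothesis reads [|E| >= 3 |V| - 5]. Removing a vertex of degree
    at most three, or contracting an edge whose ends have at most two common neighbours, costs at
    most six darts for one vertex and so preserves it; what remains is [dense_neighbourhood_K5]. *)
Theorem K5_minor_of_dense V r : symmetric r -> irreflexive r ->
  supported_on V r -> 2 < #|V| -> 6 * #|V| <= #|darts r| + 10 -> K5_minor r.
Proof.
(* The measure is lexicographic: first [|V|], then the number of darts. *)
have [m] := ubnP (#|V| * (#|{: T * T}|).+1 + #|darts r|).
elim: m V r => // m IHm V r; rewrite ltnS => le_m rs ri rV V3 dense.
have degN v : neighbours r v \subset V :\ v.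
  apply/subsetP => w; rewrite !inE => rvw; have [_ ->] := rV _ _ rvw.
  by rewrite andbT; apply: contraTneq rvw => ->; rewrite ri.
have dartsE : #|darts r| = \sum_(v in V) #|neighbours r v|.
  rewrite card_darts (bigID (mem V)) /= [X in _ + X]big1 ?addn0 // => v vV.
  apply/eqP; rewrite cards_eq0 -subset0; apply/subsetP => w; rewrite !inE => /rV[].
  by rewrite (negPf vV).
(* Three or four vertices cannot carry so many darts; hence more than two vertices are left after
   one is removed. *)
have V5 : 4 < #|V|.
  suff : #|darts r| <= #|V| * #|V|.-1 by move: V3 dense; move: #|V| => n; nia.
  rewrite dartsE -sum_nat_const leq_sum // => v vV.
  by apply: leq_trans (subset_leq_card (degN v)) _; rewrite (cardsD1 v V) vV.
(* With two darts to spare an edge can be deleted. Otherwise there are fewer than [6 |V|] darts,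
   hence a vertex of degree at most five. *)
have [slack|tight] := leqP (6 * #|V| + 2) (#|darts r| + 10).
  have [[x y]] : exists p, p \in darts r by apply/set0Pn; rewrite -card_gt0; lia.
  rewrite inE /= => rxy; have [c1 c2] := card_darts_remove_edge rxy.
  apply: (@K5_minor_sub (remove_edge r x y)); first by move=> a b /and3P[].
  apply: (IHm V) => //.
  - by move: le_m c2; lia.
  - move=> a b; rewrite /remove_edge rs !xpair_eqE andbCA.
    by rewrite [(b == x) && _]andbC [(b == y) && _]andbC.
  - by move=> a; rewrite /remove_edge ri !andbF.
  - by move=> a b /and3P[_ _ /rV].
  - lia.
have [v [vV v5]] : exists v, v \in V /\ #|neighbours r v| <= 5.
  have /exists_inP[v vV v5] : [exists v in V, #|neighbours r v| <= 5].
    apply: contraT; rewrite negb_exists_in => /forall_inP h.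
    suff : #|V| * 6 <= #|darts r| by lia.
    by rewrite dartsE -sum_nat_const leq_sum // => v /h; rewrite -ltnNge.
  by exists v.
have dropV u r' : u \in V -> #|darts r'| <= #|{: T * T}| ->
    (#|V :\ u| * #|{: T * T}|.+1 + #|darts r'| < m)%N.
  move=> uV le_r'; move: le_m; have := cardsD1 u V; rewrite uV.
  move: #|V| #|V :\ u| #|darts r| #|darts r'| #|{: T * T}| le_r' => *; nia.
have max_darts r' : #|darts r'| <= #|{: T * T}| by apply: max_card.
have cardV u : u \in V -> #|V| = #|V :\ u|.+1.
  by move=> uV; rewrite (cardsD1 u V) uV.
have [v3|v4] := leqP #|neighbours r v| 3.
  apply: (@K5_minor_sub (remove_vertex r v)); first by move=> a b /and3P[].
  have := card_darts_remove_vertex v rs; have cV := cardV v vV; move=> le_d.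
  apply: (IHm (V :\ v)); [exact: dropV | | | | lia | lia].
  - by move=> a b; rewrite /remove_vertex rs andbCA.
  - by move=> a; rewrite /remove_vertex ri !andbF.
  - move=> a b /and3P[av bv /rV[aV bV]].
    by split; apply/setD1P.
have [com|] := boolP [forall u in neighbours r v,
    2 < #|neighbours r v :&: neighbours r u|].
  apply: (@dense_neighbourhood_K5 r v) => //; first by rewrite v4 v5.
  exact/forall_inP.
case/forall_inPn => u; rewrite inE -leqNgt => rvu few.
have [_ uV] := rV _ _ rvu.
apply: (K5_minor_contract rs rvu).
have := card_darts_contract rs ri rvu; have cV := cardV u uV; move=> le_d.
apply: (IHm (V :\ u)); [exact: dropV | | | | lia | lia].
- move=> a b; rewrite /contract [a == b]eq_sym [r a b]rs [r b u]rs [r u a]rs.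
  congr (_ && _); rewrite andbCA; congr [&& _, _ & _ || _].
  exact: orbC.
- by move=> a; rewrite /contract eqxx.
- move=> a b /and4P[_ au bu E]; suff [aV bV] : a \in V /\ b \in V.
    by split; apply/setD1P.
  case/or3P: E => [/rV[//]|/andP[/eqP-> /rV[_ ->]]|/andP[/eqP-> /rV[-> _]]];
    by rewrite vV.
Qed.

End Mader.

Lemma disjoint_setUU (T : finType) (A B C D : {set T}) :
  [disjoint A & C] -> [disjoint A & D] ->
  [disjoint B & C] -> [disjoint B & D] ->
  [disjoint A :|: B & C :|: D].
Proof.
rewrite -!setI_eq0 setIUl !setIUr => /eqP-> /eqP-> /eqP-> /eqP->.
by rewrite !set0U.
Qed.

(** * Closed two-dimensional pseudomanifolds *)

(** The left kernel lies in the line of constant vectors, so its dimension is at most one. *)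
Lemma card_constant_kernel (K : fieldType) (p q : nat) (A : 'M[K]_(p, q)) :
  (forall x : 'rV_p, x *m A = 0 -> forall i j, x ord0 i = x ord0 j)%R ->
  p <= \rank A + 1.
Proof.
move=> ker_const; suff : \rank (kermx A) <= 1 by rewrite mxrank_ker; lia.
apply: leq_trans (rank_leq_row (const_mx 1 : 'rV[K]_p)%R).
apply/mxrankS/row_subP => i; case: p A ker_const i => [|p] A kc i; first by case: i.
apply/submxP; exists ((row i (kermx A)) ord0 ord0)%:M%R.
apply/rowP => j; rewrite mul_scalar_mx !mxE mulr1.
have /kc/(_ j ord0) : (row i (kermx A) *m A = 0)%R.
  by rewrite -row_mul mulmx_ker row0.
by rewrite !mxE.
Qed.

Definition adjacent (n : nat) (G : simplicial_complex n) : rel 'I_n :=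
  fun u v => (u != v) && ([set u; v] \in (G : {set {set 'I_n}})).

Section Pseudomanifolds.
Variables (n : nat) (Delta : simplicial_complex n).
Implicit Types (F G e : {set 'I_n}).
Local Notation edges := (simplices Delta 1).
Local Notation triangles := (simplices Delta 2).

Definition vertex_set : {set 'I_n} :=
  [set i | [set i] \in (Delta : {set {set 'I_n}})].

Definition two_colouring (c : {set 'I_n} -> bool) := forall e F G,
  e \in edges -> F \in cofaces2 Delta e -> G \in cofaces2 Delta e ->
  F != G -> c F != c G.

Local Notation graph_adjacent := (adjacent (graph_of Delta)).

Lemma graph_adjacentE u v : graph_adjacent u v = ([set u; v] \in edges).
Proof.
rewrite /adjacent !inE cards2; case: eqVneq => //= uv.
by rewrite andbF.
Qed.

Lemma edge_pair e u : e \in edges -> u \in e -> exists2 v, u != v & e = [set u; v].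
Proof.
rewrite inE => /andP[_ /cards2P[a [b [ab ->]]]]; rewrite !inE => /pred2P[]->.
  by exists b.
by exists a; [rewrite eq_sym | rewrite setUC].
Qed.

Lemma edge_of_triangle F e : F \in triangles ->
  (e \in edges) && (e \subset F) = (e \in [set F :\ j | j in F]).
Proof.
rewrite inE => /andP[FD /eqP F3]; apply/idP/imsetP => [/andP[]|[j jF ->]].
  rewrite inE => /andP[_ /eqP e2] eF.
  have /eqP/cards1P[j Fe] : #|F :\: e| = 1 by rewrite cardsDS // F3 e2.
  have jFe : j \in F :\: e by rewrite Fe inE.
  exists j; first by move: jFe; rewrite inE => /andP[].
  by rewrite -Fe setDDr setDv set0U; apply/esym/setIidPr.
rewrite inE (faces_closed FD (subD1set F j)) subD1set andbT.
by have := cardsD1 j F; rewrite jF F3 add1n => -[<-].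
Qed.

Lemma setD1_inj F : {in F &, injective (fun j => F :\ j)}.
Proof.
by move=> i j iF jF /setP/(_ i); rewrite !inE eqxx iF; case: eqVneq.
Qed.

Lemma card_triangle_edges F : F \in triangles ->
  #|[set e in edges | e \subset F]| = 3.
Proof.
move=> FT; have -> : [set e in edges | e \subset F] = [set F :\ j | j in F].
  by apply/setP => e; rewrite inE edge_of_triangle.
by rewrite card_in_imset; [move: FT; rewrite inE => /andP[_ /eqP] | exact: setD1_inj].
Qed.

Lemma card_triangle_edges_at F v : F \in triangles ->
  #|[set e in edges | (v \in e) && (e \subset F)]| = (v \in F) * 2.
Proof.
move=> FT; have F3 : #|F| = 3 by move: FT; rewrite inE => /andP[_ /eqP].
have -> : [set e in edges | (v \in e) && (e \subset F)] =
    [set F :\ j | j in F & (v \in F) && (j != v)].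
  apply/setP => e; rewrite inE andbCA edge_of_triangle //.
  apply/andP/imsetP => [[ve /imsetP[j jF def_e]]|[j]].
    exists j => //; move: ve; rewrite def_e !inE jF => /andP[vj ->].
    by rewrite eq_sym vj.
  rewrite inE => /and3P[jF vF jv] ->; rewrite !inE eq_sym jv vF.
  by split=> //; apply: imset_f.
rewrite card_in_imset; last first.
  by move=> i j; rewrite !inE => /andP[iF _] /andP[jF _]; apply: setD1_inj.
case vF: (v \in F); last by rewrite mul0n; apply/eqP; rewrite cards_eq0 -subset0;
   apply/subsetP => j; rewrite !inE andbF.
rewrite mul1n; have := cardsD1 v F; rewrite vF F3 add1n => -[->].
by apply: eq_card => j; rewrite !inE andbC.
Qed.

Hypothesis pseudo : pseudomanifold2 Delta.
Hypothesis no_boundary : without_boundary Delta.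

Lemma card_cofaces2 e : e \in edges -> #|cofaces2 Delta e| = 2.
Proof.
move=> eE; have [_ bd _] := pseudo; have := bd e eE.
by case: #|_| (fun h => no_boundary (ex_intro2 _ _ e eE h))
  => [|[|[|]]] // /(_ erefl).
Qed.

Lemma sub_triangle F : F \in (Delta : {set {set 'I_n}}) ->
  exists2 G, G \in triangles & F \subset G.
Proof.
move=> FD; have [G /maxsetP[GD Gmax] FG] :=
  @maxset_exists _ (fun G => G \in (Delta : {set {set 'I_n}})) F FD.
have [fac _ _] := pseudo; exists G => //; apply: fac; rewrite inE GD.
by apply/forall_inP => H HD; apply/implyP => GH; rewrite (Gmax _ HD GH).
Qed.

Lemma triangles_nonempty : exists F, F \in triangles.
Proof.
have /set0Pn[F /sub_triangle[G GT _]] := faces_nonempty Delta.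
by exists G.
Qed.

Lemma card_edges_triangles : #|edges| * 2 = #|triangles| * 3.
Proof.
rewrite -!sum_nat_const.
transitivity (\sum_(e in edges) \sum_(F in triangles) (e \subset F : nat)).
  apply: eq_bigr => e eE; rewrite -big_mkcondr sum1dep_card.
  by rewrite -[LHS](card_cofaces2 eE).
rewrite exchange_big; apply: eq_bigr => F FT.
by rewrite -big_mkcondr sum1dep_card (card_triangle_edges FT).
Qed.

Lemma triangle_connected_eq (A : eqType) (x : {set 'I_n} -> A) :
  (forall e F G, e \in edges -> F \in cofaces2 Delta e ->
     G \in cofaces2 Delta e -> F != G -> x F = x G) ->
  {in triangles &, forall F G, x F = x G}.
Proof.
move=> adj F G FT GT; have [_ _ conn] := pseudo.
have /connectP[p] := conn F G FT GT; elim: p F {FT} => [|H p IHp] F /=.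
  by move=> _ ->.
case/andP=> /and3P[FT HT FH] pp /(IHp _ pp) <-.
have [->//|nFH] := eqVneq F H.
apply: (adj _ _ _ FH); rewrite ?inE ?subsetIl ?subsetIr ?andbT //;
  by [move: FT; rewrite inE | move: HT; rewrite inE].
Qed.

(** Consecutive triangles of a chain share a vertex, and the vertices of a triangle are pairwise
    adjacent, so the graph inherits connectedness from the triangles. *)
Lemma vertex_connected_eq (A : eqType) (y : 'I_n -> A) :
  (forall u v, [set u; v] \in edges -> y u = y v) ->
  {in vertex_set &, forall u v, y u = y v}.
Proof.
move=> adj; have inT F u v : F \in triangles -> u \in F -> v \in F -> y u = y v.
  rewrite inE => /andP[FD _] uF vF; have [->//|uv] := eqVneq u v.
  apply: adj; rewrite inE cards2 uv andbT; apply: faces_closed FD _.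
  by rewrite subUset !sub1set uF.
move=> u v; rewrite !inE => /sub_triangle[F FT]; rewrite sub1set => uF.
move=> /sub_triangle[G GT]; rewrite sub1set => vG.
have [_ _ conn] := pseudo.
have /connectP[p] := conn F G FT GT.
elim: p F u {FT} (FT) uF => [|H p IHp] F u FT uF /=.
  by move=> _ eG; apply: (inT F); rewrite // -eG.
case/andP=> /and3P[_ HT]; rewrite inE => /andP[_ /cards2P[a [b [_ FH]]]] pp eG.
have /setIP[aF aH] : a \in F :&: H by rewrite FH !inE eqxx.
by rewrite (inT F u a) //; apply: IHp HT aH pp eG.
Qed.


Lemma simplices_graph k : k <= 1 ->
  simplices (graph_of Delta) k = simplices Delta k.
Proof.
move=> k1; apply/setP => e; rewrite !inE.
by case: (eqVneq #|e| k.+1) => [->|]; rewrite ?andbF ?ltnS ?k1 ?andbT.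
Qed.

Lemma card_neighbours u :
  #|neighbours graph_adjacent u| = #|[set e in edges | u \in e]|.
Proof.
have -> : [set e in edges | u \in e] =
    [set [set u; v] | v in neighbours graph_adjacent u].
  apply/setP => e; rewrite inE; apply/andP/imsetP => [[eE ue]|[v]].
    have [v _ def_e] := edge_pair eE ue.
    by exists v; rewrite // inE graph_adjacentE -def_e.
  by rewrite inE graph_adjacentE => uvE ->; split; rewrite // !inE eqxx.
rewrite card_in_imset // => v w; rewrite !inE => /andP[uv _] /andP[uw _].
by move/setP/(_ v); rewrite !inE eqxx orbT eq_sym (negPf uv) /= => /esym/eqP.
Qed.

Lemma card_darts_graph : #|darts graph_adjacent| = #|edges| * 2.
Proof.
rewrite card_darts -sum_nat_const.
transitivity (\sum_u \sum_(e in edges) (u \in e : nat)).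
  by apply: eq_bigr => u _; rewrite card_neighbours -big_mkcondr sum1dep_card.
rewrite exchange_big; apply: eq_bigr => e; rewrite inE => /andP[_ /eqP e2].
by rewrite -big_mkcond sum1_card.
Qed.

(** This is the planar bound [f_1 <= 3 f_0 - 6], written without truncated subtraction. *)
Lemma no_K5_minor_card_edges : ~ K5_minor graph_adjacent ->
  #|edges| + 6 <= 3 * #|vertex_set|.
Proof.
move=> noK5; rewrite leqNgt; apply/negP => lt; apply: noK5.
apply: (@K5_minor_of_dense _ vertex_set).
- by move=> u v; rewrite !graph_adjacentE setUC.
- by move=> u; rewrite /adjacent eqxx.
- move=> u v; rewrite graph_adjacentE inE => /andP[uvD _].
  by rewrite !inE !(faces_closed uvD) // sub1set !inE eqxx ?orbT.
- have [F] := triangles_nonempty; rewrite inE => /andP[FD /eqP F3].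
  rewrite -F3; apply/subset_leq_card/subsetP => u uF.
  by rewrite inE (faces_closed FD) // sub1set.
- by rewrite card_darts_graph; move: lt; rewrite -ltnS; lia.
Qed.

Lemma cofaces2E e F G : e \in edges -> F \in cofaces2 Delta e ->
  G \in cofaces2 Delta e -> F != G -> cofaces2 Delta e = [set F; G].
Proof.
move=> eE Fe Ge FG; apply/esym/eqP; rewrite eqEcard card_cofaces2 // cards2 FG.
by rewrite subUset !sub1set Fe Ge.
Qed.

(** * Homology over the field with two elements *)

Section Homology.
Local Open Scope ring_scope.
Local Notation F2 := 'F_2.

(** The simplicial boundary maps over [F2], acting on row vectors. *)
Let d2 : 'M[F2]_(#|triangles|, #|edges|) :=
  \matrix_(i < #|triangles|, j < #|edges|) (enum_val j \subset enum_val i)%:R.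
Let d1 : 'M[F2]_(#|edges|, #|vertex_set|) :=
  \matrix_(i < #|edges|, j < #|vertex_set|) (enum_val j \in enum_val i)%:R.

Let sum_bool (T : finType) (A : {set T}) (P : pred T) :
  \sum_(i < #|A|) ((P (enum_val i))%:R : F2) = (#|[set x in A | P x]|)%:R.
Proof.
rewrite -(big_enum_val (fun x => (P x)%:R)) /= -natr_sum; congr (_%:R).
by rewrite -big_mkcondr sum1dep_card.
Qed.

(** In a 2-cycle the coefficients of the two triangles at an edge add up to zero, so they are equal
    in characteristic 2; connectedness makes the cycle constant. *)
Let d2K (x : 'rV_#|triangles|) : x *m d2 = 0 -> forall i j, x ord0 i = x ord0 j.
Proof.
move=> x0 i j.
have [F FT] := triangles_nonempty.
pose z G := x ord0 (enum_rank_in FT G).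
have zE k : x ord0 k = z (enum_val k) by rewrite /z enum_valK_in.
rewrite !zE; apply: triangle_connected_eq; try exact: enum_valP.
move=> e G H eE Ge He GH; have := congr1 (fun M : 'rV_ _ => M ord0 (enum_rank_in eE e)) x0.
rewrite !mxE; under eq_bigr do rewrite zE mxE enum_rankK_in //.
rewrite -(big_enum_val (fun G => z G * (e \subset G)%:R)) /=.
rewrite (eq_bigr (fun G => if e \subset G then z G else 0)); last first.
  by move=> G' _; case: ifP => _; rewrite ?mulr1 ?mulr0.
rewrite -big_mkcondr (eq_bigl (mem (cofaces2 Delta e))); last by move=> G'; rewrite !inE.
rewrite (cofaces2E eE Ge He GH) big_setU1 ?inE // big_set1 => /eqP.
by rewrite addr_eq0 => /eqP->; rewrite oppr_pchar2 // pchar_Fp.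
Qed.

(** The transpose of [d1] is the coboundary on vertex functions; its kernel is constant because the
    graph is connected. *)
Let d1K (y : 'rV_#|vertex_set|) : y *m d1^T = 0 -> forall i j, y ord0 i = y ord0 j.
Proof.
move=> y0 i j; have iV := enum_valP i.
pose z u := y ord0 (enum_rank_in iV u).
have zE k : y ord0 k = z (enum_val k) by rewrite /z enum_valK_in.
rewrite !zE; apply: vertex_connected_eq; try exact: enum_valP.
move=> u v eE; have [->//|uv] := eqVneq u v.
have := congr1 (fun M : 'rV_ _ => M ord0 (enum_rank_in eE [set u; v])) y0.
rewrite !mxE; under eq_bigr do rewrite zE !mxE enum_rankK_in //.
rewrite -(big_enum_val (fun w => z w * (w \in [set u; v])%:R)) /=.
rewrite (eq_bigr (fun w => if w \in [set u; v] then z w else 0)); last first.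
  by move=> w _; case: ifP => _; rewrite ?mulr1 ?mulr0.
rewrite -big_mkcondr (eq_bigl (mem [set u; v])); last first.
  move=> w; rewrite andbC; apply: andb_idr; rewrite !inE => wuv.
  move: eE; rewrite inE => /andP[uvD _]; apply: faces_closed uvD _.
  by rewrite sub1set !inE.
rewrite big_setU1 ?inE // big_set1 => /eqP.
by rewrite addr_eq0 => /eqP->; rewrite oppr_pchar2 // pchar_Fp.
Qed.

Let d2d1 : d2 *m d1 = 0.
Proof.
apply/matrixP => i j; rewrite !mxE; under eq_bigr do rewrite !mxE -natrM mulnb andbC.
rewrite (@sum_bool _ edges (fun e => (enum_val j \in e) && (e \subset enum_val i))).
rewrite card_triangle_edges_at ?enum_valP // natrM.
by rewrite [2%:R](pcharf0 (pchar_Fp (isT : prime 2))) mulr0.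
Qed.

(* The Euler characteristic bound forces the first homology over F_2 to vanish;
   the sum of all edges is a cycle when all degrees are even, hence a boundary. *)
Lemma eulerian_two_colourable : eulerian (graph_of Delta) ->
    (#|edges| + 6 <= 3 * #|vertex_set|)%N ->
  exists c, two_colouring c.
Proof.
move=> eul card_edges.
have cycle : const_mx 1 *m d1 = 0 :> 'rV_ _.
  apply/rowP => j; rewrite !mxE; under eq_bigr do rewrite !mxE mul1r.
  rewrite (@sum_bool _ edges (fun e => enum_val j \in e)).
  have := eul (enum_val j); rewrite /degree !simplices_graph // !inE cards1.
  have := enum_valP j; rewrite inE => -> /(_ isT) even.
  by rewrite -(odd_double_half #|_|) (negPf even) add0n -muln2 natrM
    [2%:R](pcharf0 (pchar_Fp (isT : prime 2))) mulr0.
have le1 := card_constant_kernel d1K; rewrite mxrank_tr in le1.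
have le2 := card_constant_kernel d2K.
have sub : (d2 <= kermx d1)%MS by apply/sub_kermxP; exact: d2d1.
(* From [2 f_1 = 3 f_2] and [f_1 + 6 <= 3 f_0] it follows that [dim ker d1 <= f_1 - f_0 + 1 <= f_2 -
   1 <= rank d2]. *)
have sup : (kermx d1 <= d2)%MS.
  rewrite -(geq_leqif (mxrank_leqif_sup sub)) mxrank_ker.
  by have := card_edges_triangles; lia.
have /submxP[x ones] : ((const_mx 1 : 'rV_#|edges|) <= d2)%MS.
  by apply: submx_trans sup; apply/sub_kermxP.
have [F0 FT] := triangles_nonempty.
pose z G := x ord0 (enum_rank_in FT G).
(* The boundary of the chain has coefficient 1 at every edge, so exactly one of the two triangles
   there belongs to the chain. *)
exists (fun F => z F != 0) => e F G eE Fe Ge FG.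
have := congr1 (fun M : 'rV_ _ => M ord0 (enum_rank_in eE e)) ones.
rewrite !mxE; under eq_bigr do rewrite mxE enum_rankK_in //.
have zE k : x ord0 k = z (enum_val k) by rewrite /z enum_valK_in.
under eq_bigr do rewrite zE.
rewrite -(big_enum_val (fun G => z G * (e \subset G)%:R)) /=.
rewrite (eq_bigr (fun G => if e \subset G then z G else 0)); last first.
  by move=> G' _; case: ifP => _; rewrite ?mulr1 ?mulr0.
rewrite -big_mkcondr (eq_bigl (mem (cofaces2 Delta e))); last by move=> G'; rewrite !inE.
rewrite (cofaces2E eE Fe Ge FG) big_setU1 ?inE // big_set1.
by case: (z F) (z G) => [[|[|//]] ?] [[|[|//]] ?].
Qed.

End Homology.

Lemma two_colourable_eulerian c : two_colouring c ->
  eulerian (graph_of Delta).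
Proof.
move=> col v _; rewrite /degree simplices_graph //.
have -> : #|[set e in edges | v \in e]| =
    \sum_(e in edges | v \in e) #|[set F in cofaces2 Delta e | c F]|.
  rewrite -sum1dep_card; apply: eq_bigr => e /andP[eE _].
  have /eqP/cards2P[F [G [FG def]]] := card_cofaces2 eE.
  have Fe : F \in cofaces2 Delta e by rewrite def !inE eqxx.
  have Ge : G \in cofaces2 Delta e by rewrite def !inE eqxx orbT.
  have cFG := col e F G eE Fe Ge FG.
  apply/esym/eqP/cards1P; exists (if c F then F else G).
  apply/setP => H; rewrite inE def !inE.
  case: (eqVneq H F) => [->|HF] /=.
    by case: ifP => cF; rewrite ?eqxx // (negPf FG).
  case: (eqVneq H G) => [->|HG] /=.
    by move: cFG; case: (c F); case: (c G); rewrite ?eqxx // [G == F]eq_sym (negPf FG).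
  by case: ifP; rewrite ?(negPf HF) ?(negPf HG).
rewrite (eq_bigr (fun e => \sum_(F in triangles | c F) (e \subset F : nat))); last first.
  move=> e _; rewrite -sum1dep_card -big_mkcondr.
  by apply: eq_bigl => F; rewrite !inE -!andbA [c F && _]andbC.
rewrite exchange_big /= (eq_bigr (fun F => (v \in F) * 2)) => [|F /andP[FT _]].
  by rewrite -big_distrl /= muln2 odd_double.
rewrite -card_triangle_edges_at // -big_mkcondr sum1dep_card.
by apply: eq_card => e; rewrite !inE andbA.
Qed.

End Pseudomanifolds.

From mathcomp Require Import generic_quotient ring_quotient mpoly boolp.

(** * The algebra in degrees two and three *)

Section SquarefreeAlgebra.
Local Open Scope ring_scope.
Variables (k : fieldType) (n : nat) (Delta : simplicial_complex n).
Implicit Types (F G e : {set 'I_n}) (f g : {mpoly k[n]}) (m : 'X_{1..n}).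

Definition mon F : 'X_{1..n} := [multinom (i \in F : nat) | i < n].

Lemma mpolyX_mon F : 'X_[mon F] = \prod_(i in F) 'X_i :> {mpoly k[n]}.
Proof.
rewrite mpolyXE_id [RHS]big_mkcond; apply: eq_bigr => i _.
by rewrite mnmE; case: ifP.
Qed.

Lemma mon_inj : injective mon.
Proof.
move=> F G /mnmP e; apply/setP => i; have := e i.
by rewrite !mnmE; do 2!case: (i \in _).
Qed.

Lemma mdeg_mon F : mdeg (mon F) = #|F|.
Proof.
rewrite mdegE -sum1_card [RHS]big_mkcond.
by apply: eq_bigr => i _; rewrite mnmE; case: ifP.
Qed.

Lemma mnm_mon m : (forall i, m i <= 1)%N -> m = mon [set i | m i != 0%N].
Proof.
by move=> m1; apply/mnmP => i; rewrite mnmE inE; have := m1 i; case: (m i) => [|[|]].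
Qed.

Lemma mon_add_sub F m1 m2 : mon F = (m1 + m2)%MM ->
  exists2 G : {set 'I_n}, G \subset F & m2 = mon G.
Proof.
move=> /mnmP e; have le i : (m2 i <= (i \in F))%N.
  by have := e i; rewrite mnmE mnmDE => ->; apply: leq_addl.
exists [set i | m2 i != 0%N].
  by apply/subsetP => i; rewrite inE; have := le i; case: (i \in F) => //; case: (m2 i).
by apply: mnm_mon => i; apply: leq_trans (le i) (leq_b1 _).
Qed.

Lemma mon_setD1 F j : j \in F -> mon F = (U_(j) + mon (F :\ j))%MM.
Proof.
move=> jF; apply/mnmP => i; rewrite mnmDE mnm1E !mnmE !inE.
by rewrite [i == j]eq_sym; case: eqVneq => [<-|]; rewrite ?jF.
Qed.

(** By [defining_idealP] this is membership in the defining ideal: the monomials of faces form a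
    basis of the quotient. *)
Definition faceless f :=
  forall F, F \in (Delta : {set {set 'I_n}}) -> f@_(mon F) = 0.

(** Divisors of the monomial of a face are again monomials of faces, as faces are closed under
    taking subsets. *)
Lemma facelessMD a f g : faceless f -> faceless g -> faceless (a * f + g).
Proof.
move=> f0 g0 F FD; rewrite mcoeffD g0 // addr0 mcoeffM big1 // => -[m1 m2] /eqP /=.
move=> /mon_add_sub[G GF ->]; rewrite f0 ?mulr0 //; exact: faces_closed FD GF.
Qed.

Lemma ideal_span_incl (E : {mpoly k[n]} -> Prop) f : E f -> ideal_span E f.
Proof.
move=> Ef; exists [:: (1, f)]; last by rewrite big_seq1 mul1r.
by move=> cg; rewrite inE => /eqP->.
Qed.

(** Both kinds of generators are faceless. Conversely, each monomial in the support of a faceless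
    polynomial is divisible by the square of a variable or belongs to a non-face. *)
Lemma defining_idealP f : defining_ideal Delta f <-> faceless f.
Proof.
split.
  apply: ideal_span_sub; first by move=> F _; rewrite mcoeff0.
    exact: facelessMD.
  move=> g [[i ->] F _|].
    rewrite mcoeffXn; case: eqP => // /mnmP/(_ i).
    by rewrite mulmnE mnm1E eqxx mnmE; case: (i \in F).
  apply: ideal_span_sub; first by move=> F _; rewrite mcoeff0.
    exact: facelessMD.
  move=> {}g [G GND ->] F FD; rewrite -mpolyX_mon mcoeffX.
  by case: eqP => // /mon_inj e; rewrite e FD in GND.
move=> f0; rewrite [f]mpolyE big_seq.
elim/big_rec: _ => [|m g mf gI]; first exact: ideal_span0.
rewrite -mul_mpolyC; apply: ideal_spanMD gI.
have [[i mi]|sqf] : (exists i, 1 < m i)%N \/ (forall i, m i <= 1)%N.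
  have [/existsP[i mi]|/existsPn h] := boolP [exists i, 1 < m i]%N.
    by left; exists i.
  by right=> i; rewrite leqNgt.
  have -> : m = ((m - U_(i) *+ 2) + U_(i) *+ 2)%MM.
    rewrite submK //; apply/mnm_lepP => j; rewrite mulmnE mnm1E.
    by case: eqP => [<-|]; rewrite ?mul0n.
  rewrite mpolyXD -mpolyXn -[_ * _]addr0.
  apply: ideal_spanMD; last exact: ideal_span0.
  by apply: ideal_span_incl; left; exists i.
rewrite (mnm_mon sqf) in mf *; set F := [set i | _] in mf *.
have FD : F \notin (Delta : {set {set 'I_n}}).
  by apply: contraL mf => FD; rewrite -mcoeff_eq0 f0.
apply: ideal_span_incl; right; apply: ideal_span_incl; exists F => //.
exact: mpolyX_mon.
Qed.

Lemma residueP f g : residue Delta f = residue Delta g <-> faceless (f - g).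
Proof.
rewrite -defining_idealP; split=> [/eqP|I].
  by rewrite /residue -Quotient.idealrBE => /asboolP.
by apply/eqP; rewrite /residue -Quotient.idealrBE; apply/asboolP.
Qed.

Lemma residueM f g : residue Delta (f * g) = residue Delta f * residue Delta g.
Proof. exact: rmorphM. Qed.

Lemma mcoeff_linear_form_mul (a : 'I_n -> k) f F :
  (linear_form a * f)@_(mon F) = \sum_(j in F) a j * f@_(mon (F :\ j)).
Proof.
rewrite /linear_form mulr_suml raddf_sum /= [RHS]big_mkcond /=.
apply: eq_bigr => j _; rewrite -scalerAl mcoeffZ; case: ifPn => jF.
  by rewrite (mon_setD1 jF) ['X_j * f]mulrC mcoeffMX.
rewrite mcoeffM big1 ?mulr0 // => -[m1 m2] /= /eqP/mnmP/(_ j).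
rewrite mnmE (negPf jF) mnmDE mcoeffX; case: eqP => [<-|]; last by rewrite mul0r.
by rewrite mnm1E eqxx.
Qed.

Definition face_poly (S : {set {set 'I_n}}) (c : {set 'I_n} -> k) : {mpoly k[n]} :=
  \sum_(e in S) c e *: 'X_[mon e].

Lemma mcoeff_face_poly S c F :
  (face_poly S c)@_(mon F) = if F \in S then c F else 0.
Proof.
rewrite /face_poly raddf_sum /=.
rewrite (eq_bigr (fun e => if e == F then c e else 0)).
  rewrite -big_mkcondr; case: ifP => FS.
    rewrite (big_pred1 F) // => e /=.
    by have [->|] := eqVneq e F; rewrite ?FS ?andbF.
  rewrite big_pred0 // => e.
  by have [->|] := eqVneq e F; rewrite ?FS ?andbF.
move=> e _; rewrite mcoeffZ mcoeffX (inj_eq mon_inj).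
by case: eqP; rewrite ?mulr1 ?mulr0.
Qed.

Lemma face_poly_homog i c : face_poly (simplices Delta i) c \is i.+1.-homog.
Proof.
apply: rpred_sum => e; rewrite inE => /andP[_ /eqP e2]; apply: rpredZ.
by rewrite dhomogX /= mdeg_mon e2.
Qed.

Lemma mcoeff_homog i f F : f \is i.-homog -> #|F| != i -> f@_(mon F) = 0.
Proof.
move=> /dhomogP fh Fi; apply/eqP; rewrite mcoeff_eq0; apply: contra Fi => /fh <-.
by rewrite /= mdeg_mon.
Qed.

Lemma triangle_setD1 F j : F \in simplices Delta 2 -> j \in F ->
  F :\ j \in simplices Delta 1.
Proof.
move=> FT jF; have : F :\ j \in [set F :\ j | j in F] by apply: imset_f.
by rewrite -(edge_of_triangle _ FT) => /andP[].
Qed.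

Lemma linear_form_homog (a : 'I_n -> k) : linear_form a \is 1.-homog.
Proof.
by apply: rpred_sum => j _; apply: rpredZ; rewrite dhomogX /= mdeg1.
Qed.

(** In coordinates: [c] gives the coefficients of a quadric at the edges, and the sums are the
    coefficients of its product with the form at the triangles. *)
Lemma mult_injectiveP (a : 'I_n -> k) :
  mult_injective (residue Delta (linear_form a)) 2 ->
  forall c : {set 'I_n} -> k,
    (forall F, F \in simplices Delta 2 -> \sum_(j in F) a j * c (F :\ j) = 0) ->
  forall e, e \in simplices Delta 1 -> c e = 0.
Proof.
move=> inj c c0 e eE; pose f := face_poly (simplices Delta 1) c.
have fh : f \is 2.-homog by apply: face_poly_homog.
have : residue Delta f = residue Delta 0.
  apply: inj; [by exists f | by exists 0; rewrite ?rpred0 |].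
  rewrite -!residueM; apply/residueP => F FD; rewrite mulr0 subr0.
  have [F3|F3] := eqVneq #|F| 3%N.
    have FT : F \in simplices Delta 2 by rewrite inE FD F3.
    rewrite mcoeff_linear_form_mul -[RHS](c0 F FT); apply: eq_bigr => j jF.
    by rewrite mcoeff_face_poly triangle_setD1.
  apply: mcoeff_homog F3; exact: dhomogM (linear_form_homog a) fh.
move/residueP => /(_ e); rewrite subr0 mcoeff_face_poly eE; apply.
by move: eE; rewrite inE => /andP[].
Qed.

Lemma mult_surjectiveP (a : 'I_n -> k) :
  mult_surjective (residue Delta (linear_form a)) 2 <->
  forall w : {set 'I_n} -> k, exists c : {set 'I_n} -> k,
    forall F, F \in simplices Delta 2 -> \sum_(j in F) a j * c (F :\ j) = w F.
Proof.
split=> [surj w|surj _ [g gh ->]].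
  have [|_ [f fh ->]] := surj (residue Delta (face_poly (simplices Delta 2) w)).
    by exists (face_poly (simplices Delta 2) w); rewrite ?face_poly_homog.
  rewrite -residueM => /residueP e; exists (fun e => f@_(mon e)) => F FT.
  have FD : F \in (Delta : {set {set 'I_n}}) by move: FT; rewrite inE => /andP[].
  move: (e F FD); rewrite mcoeffB mcoeff_face_poly FT mcoeff_linear_form_mul.
  by move/eqP; rewrite subr_eq0 => /eqP.
have [c cE] := surj (fun F => g@_(mon F)).
pose f := face_poly (simplices Delta 1) c.
have fh : f \is 2.-homog by apply: face_poly_homog.
exists (residue Delta f); first by exists f.
rewrite -residueM; apply/residueP => F FD; rewrite mcoeffB.
have [F3|F3] := eqVneq #|F| 3%N.
  have FT : F \in simplices Delta 2 by rewrite inE FD F3.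
  rewrite mcoeff_linear_form_mul -(cE F FT); apply/eqP; rewrite subr_eq0; apply/eqP.
  by apply: eq_bigr => j jF; rewrite mcoeff_face_poly triangle_setD1.
rewrite !(mcoeff_homog _ F3) ?subrr //.
exact: dhomogM (linear_form_homog a) fh.
Qed.

(** On the line through [a] in direction [(1, ..., 1)] the product of [p] and all variables is a
    non-zero polynomial in one variable, and in characteristic 0 the integers provide more points
    than it has roots. *)
Lemma exists_nonzero_coordinates (p : {mpoly k[n]}) (a : 'I_n -> k) :
    [pchar k] =i pred0 -> p.@[a] != 0 ->
  exists2 b : 'I_n -> k, p.@[b] != 0 & forall i, b i != 0.
Proof.
move=> char0 pa.
pose q := \sum_(m <- msupp p) (p@_m)%:P * \prod_i ((a i)%:P + 'X) ^+ m i.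
have qE t : q.[t] = p.@[fun i => a i + t].
  rewrite mevalE horner_sum; apply: eq_bigr => m _.
  rewrite hornerM hornerC horner_prod; congr (_ * _); apply: eq_bigr => i _.
  by rewrite horner_exp hornerD hornerC hornerX.
have q0 : q != 0.
  apply: contraNneq pa => q0; have := qE 0; rewrite q0 horner0 => /esym.
  by move=> <-; apply/eqP/meval_eq => i; rewrite addr0.
pose r := q * \prod_i ((a i)%:P + 'X).
have r0 : r != 0.
  rewrite mulf_neq0 //; apply/prodf_neq0 => i _.
  by rewrite addrC -size_poly_eq0 size_XaddC.
pose s : seq k := [seq j%:R | j <- iota 0 (size r)].
have us : uniq s.
  rewrite map_inj_uniq ?iota_uniq // => i j /eqP; have /pcharf0P ch := char0.
  wlog le_ij : i j / (i <= j)%N => [sym|].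
    by case/orP: (leq_total i j) => /sym // h /eqP e; rewrite h // e.
  rewrite eq_sym -subr_eq0 -natrB // ch subn_eq0 => le_ji.
  by apply/eqP; rewrite eqn_leq le_ij.
have /allPn[t _ nr] : ~~ all (root r) s.
  by apply/negP => /(max_poly_roots r0)/(_ us); rewrite size_map size_iota ltnn.
move: nr; rewrite /root hornerM mulf_eq0 negb_or qE => /andP[pt].
rewrite horner_prod => /prodf_neq0 at0.
exists (fun i => a i + t) => // i.
by have := at0 i isT; rewrite hornerD hornerC hornerX.
Qed.

End SquarefreeAlgebra.

(** * Multiplication by a linear form from edges to triangles *)

Section LefschetzDegree2.
Local Open Scope ring_scope.
Variables (k : fieldType) (n : nat) (Delta : simplicial_complex n).
Hypothesis char0 : [pchar k] =i pred0.
Hypothesis pseudo : pseudomanifold2 Delta.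
Hypothesis no_boundary : without_boundary Delta.
Implicit Types (F G e : {set 'I_n}) (a : 'I_n -> k) (x w : {set 'I_n} -> k).
Local Notation edges := (simplices Delta 1).
Local Notation triangles := (simplices Delta 2).

(** Matrix entry of multiplication by the form, in the bases of edge and triangle monomials. *)
Definition incidence a e F : k := \sum_(v in F) a v * (e == F :\ v)%:R.

Lemma sum_incidence a x F : F \in triangles ->
  \sum_(v in F) a v * x (F :\ v) = \sum_(e in edges) x e * incidence a e F.
Proof.
move=> FT; under [RHS]eq_bigr do rewrite mulr_sumr.
rewrite exchange_big; apply: eq_bigr => v vF.
rewrite (bigD1 (F :\ v)) /= ?triangle_setD1 // eqxx mulr1 mulrC.
by rewrite big1 ?addr0 // => e /andP[_ /negPf->]; rewrite !mulr0.
Qed.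

(* Weighting a face by the product of its coefficients reduces the linear form
   to the sum of the variables. *)
Lemma incidence_weight a e F : e \in edges -> F \in triangles ->
  incidence a e F * \prod_(i in e) a i =
  if e \subset F then \prod_(i in F) a i else 0.
Proof.
move=> eE FT; have := edge_of_triangle e FT; rewrite eE /= => ->.
rewrite /incidence; case: imsetP => [[v vF ->]|nF].
  rewrite (bigD1 v) //= eqxx mulr1 big1 ?addr0; first by rewrite (big_setD1 v vF).
  move=> u /andP[uF uv]; case: eqP => [e'|]; last by rewrite mulr0.
  by rewrite (setD1_inj vF uF e') eqxx in uv.
rewrite big1 ?mul0r // => v vF; case: eqP => [e'|]; last by rewrite mulr0.
by case: nF; exists v.
Qed.

Lemma not_mult_injective a : ~ mult_injective (residue Delta (linear_form a)) 2.
Proof.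
move=> /mult_injectiveP inj.
pose M : 'M[k]_(#|edges|, #|triangles|) :=
  \matrix_(i < #|edges|, j < #|triangles|) incidence a (enum_val i) (enum_val j).
have [F0 F0T] := triangles_nonempty pseudo.
have T0 : (0 < #|triangles|)%N by apply/card_gt0P; exists F0.
have /rowV0Pn[y /sub_kermxP yM] : kermx M != 0.
  rewrite -mxrank_eq0 mxrank_ker subn_eq0 -ltnNge.
  apply: leq_ltn_trans (rank_leq_col M) _.
  by have := card_edges_triangles pseudo no_boundary; lia.
case/eqP; apply/rowP => i; have eE := enum_valP i.
pose c e := y ord0 (enum_rank_in eE e).
have cE j : y ord0 j = c (enum_val j) by rewrite /c enum_valK_in.
rewrite cE mxE; apply: (inj c) => [F FT|]; last exact: eE.
rewrite sum_incidence //.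
have := congr1 (fun A : 'rV_ _ => A ord0 (enum_rank_in FT F)) yM; rewrite !mxE => M0.
rewrite -[RHS]M0 [LHS]big_enum_val; apply: eq_bigr => j _.
by rewrite cE mxE enum_rankK_in.
Qed.

(** A linear map is surjective exactly when its transpose is injective. *)
Lemma mult_surjective_dual a :
  mult_surjective (residue Delta (linear_form a)) 2 <->
  forall x,
    (forall e, e \in edges ->
       \sum_(F in triangles) x F * incidence a e F = 0) ->
    forall F, F \in triangles -> x F = 0.
Proof.
rewrite mult_surjectiveP; split=> [surj x x0 F FT|dual w].
  have [c cE] := surj (fun G => (G == F)%:R).
  transitivity (\sum_(G in triangles) x G * \sum_(v in G) a v * c (G :\ v)).
    rewrite (bigD1 F) //= cE // eqxx mulr1 big1 ?addr0 // => G /andP[GT /negPf GF].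
    by rewrite cE // GF mulr0.
  rewrite (eq_bigr (fun G => \sum_(e in edges) c e * (x G * incidence a e G))).
    by rewrite exchange_big big1 //= => e eE; rewrite -mulr_sumr x0 // mulr0.
  move=> G GT; rewrite sum_incidence // mulr_sumr.
  by apply: eq_bigr => e _; rewrite mulrCA.
pose M : 'M[k]_(#|edges|, #|triangles|) :=
  \matrix_(i < #|edges|, j < #|triangles|) incidence a (enum_val i) (enum_val j).
have [F0 F0T] := triangles_nonempty pseudo.
have full : row_full M.
  rewrite /row_full -mxrank_tr; apply: inj_row_free => y yM.
  pose x F := y ord0 (enum_rank_in F0T F).
  have xE j : y ord0 j = x (enum_val j) by rewrite /x enum_valK_in.
  apply/rowP => j; rewrite xE mxE; apply: dual (enum_valP j) => e eE.
  have := congr1 (fun A : 'rV_ _ => A ord0 (enum_rank_in eE e)) yM.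
  rewrite !mxE => M0; rewrite -[RHS]M0 [LHS]big_enum_val; apply: eq_bigr => i _.
  by rewrite xE !mxE enum_rankK_in.
(* Some edge is needed as the default of [enum_rank_in]. *)
have [v vF] : exists v, v \in F0.
  by apply/card_gt0P; move: F0T; rewrite inE => /andP[_ /eqP->].
have e0E := triangle_setD1 F0T vF.
have /submxP[y yM] := submx_full (\row_(j < #|triangles|) w (enum_val j)) full.
pose c e := y ord0 (enum_rank_in e0E e); exists c => F FT.
have cE j : y ord0 j = c (enum_val j) by rewrite /c enum_valK_in.
rewrite sum_incidence //.
have := congr1 (fun A : 'rV_ _ => A ord0 (enum_rank_in FT F)) yM.
rewrite !mxE enum_rankK_in // => ->; rewrite [LHS]big_enum_val; apply: eq_bigr => i _.
by rewrite cE mxE enum_rankK_in.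
Qed.

(** For non-zero weights, the dual equation at [e] thus asks that the weighted values on the
    triangles at [e] add up to zero. *)
Lemma sum_incidence_weight a x e : e \in edges ->
  (\sum_(F in triangles) x F * incidence a e F) * \prod_(i in e) a i =
  \sum_(F in cofaces2 Delta e) x F * \prod_(i in F) a i.
Proof.
move=> eE; rewrite mulr_suml.
rewrite (eq_bigr (fun F => if e \subset F then x F * \prod_(i in F) a i else 0)).
  by rewrite -big_mkcondr; apply: eq_bigl => F; rewrite !inE.
by move=> F FT; rewrite -mulrA incidence_weight //; case: ifP; rewrite ?mulr0.
Qed.

(** A non-zero dual solution, once weighted, changes sign across every edge. Its square is therefore
    constant, and as [z F] differs from [- z F] in characteristic 0, its two values colour the
    triangles. *)
Lemma mult_surjective_not_eulerian a : (forall i, a i != 0) ->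
  ~ eulerian (graph_of Delta) -> mult_surjective (residue Delta (linear_form a)) 2.
Proof.
move=> a0 not_eul; apply/mult_surjective_dual => x x0 F FT; apply: contrapT => xF0.
apply: not_eul; pose z G := x G * \prod_(i in G) a i.
have zF0 : z F != 0.
  by rewrite mulf_neq0 //; [apply/eqP | apply/prodf_neq0 => i _].
have zN e G H : e \in edges -> G \in cofaces2 Delta e -> H \in cofaces2 Delta e ->
    G != H -> z G = - z H.
  move=> eE Ge He GH; apply/eqP; rewrite -addr_eq0; apply/eqP.
  have := sum_incidence_weight a x eE; rewrite x0 // mul0r.
  by rewrite (cofaces2E pseudo no_boundary eE Ge He GH) big_setU1 ?inE // big_set1.
have zsq : {in triangles &, forall G H, z G ^+ 2 = z H ^+ 2}.
  apply: (triangle_connected_eq pseudo) => e G H eE Ge He GH.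
  by rewrite (zN e G H) // sqrrN.
have zN0 : (- z F == z F) = false.
  apply/negbTE; rewrite eq_sym -subr_eq0 opprK -mulr2n -mulr_natr mulf_neq0 //.
  by rewrite ((pcharf0P _).1 char0).
apply: (two_colourable_eulerian pseudo no_boundary (c := fun G => z G == z F)).
move=> e G H eE Ge He GH; rewrite (zN e G H) //.
have HT : H \in triangles by move: He; rewrite inE => /andP[].
have /eqP := zsq H F HT FT; rewrite eqf_sqr => /orP[]/eqP->.
  by rewrite zN0 eqxx.
by rewrite opprK zN0 eqxx.
Qed.

Lemma not_mult_surjective_two_colourable a c :
    (forall i, a i != 0) -> two_colouring Delta c ->
  ~ mult_surjective (residue Delta (linear_form a)) 2.
Proof.
move=> a0 col /mult_surjective_dual dual.
have prod0 e : \prod_(i in e) a i != 0 by apply/prodf_neq0 => i _.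
have [F FT] := triangles_nonempty pseudo.
(* Dividing by the weight leaves opposite signs on the two triangles at an edge. *)
pose x F : k := (-1) ^+ c F / \prod_(i in F) a i.
suff x0 e : e \in edges -> \sum_(F in triangles) x F * incidence a e F = 0.
  have /eqP := dual x x0 F FT.
  by rewrite mulf_eq0 signr_eq0 invr_eq0 (negPf (prod0 F)).
move=> eE; apply: (mulIf (prod0 e)).
rewrite sum_incidence_weight // mul0r.
have /eqP/cards2P[G [H [GH def]]] := card_cofaces2 pseudo no_boundary eE.
have Ge : G \in cofaces2 Delta e by rewrite def !inE eqxx.
have He : H \in cofaces2 Delta e by rewrite def !inE eqxx orbT.
rewrite def big_setU1 ?inE // big_set1 /x !divfK //.
by have := col e G H eE Ge He GH; case: (c G); case: (c H) => //= _;
  rewrite expr0 expr1 ?subrr ?addNr.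
Qed.

Lemma WLP_not_eulerian : ~ eulerian (graph_of Delta) -> WLP_in_degree k Delta 2.
Proof.
move=> not_eul; exists (fun a => forall i, a i != 0); split.
- exists (fun p => p = \prod_i 'X_i) => a; split=> [a0|[p ->]].
    exists (\prod_i 'X_i) => //; rewrite rmorph_prod /=.
    by apply/prodf_neq0 => i _; rewrite mevalXU.
  by rewrite rmorph_prod /= => /prodf_neq0 p0 i; have := p0 i isT; rewrite mevalXU.
- by exists (fun=> 1) => i; rewrite oner_eq0.
- by move=> a a0; right; apply: mult_surjective_not_eulerian.
Qed.

(** Every non-empty open set contains a form with all coefficients non-zero, and for such a form
    both alternatives fail. *)
Lemma WLP_not_two_colourable c : two_colouring Delta c ->
  ~ WLP_in_degree k Delta 2.
Proof.
move=> col [U [[E UE] [a /UE[p Ep pa]] wlp]].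
have [b pb b0] := exists_nonzero_coordinates char0 pa.
have /wlp[] : U b by apply/UE; exists p.
  exact: not_mult_injective.
exact: not_mult_surjective_two_colourable b0 col.
Qed.

End LefschetzDegree2.

From mathcomp Require Import classical_sets functions topology.
From mathcomp Require Import normedtype derive.

(** * Topologically planar graphs *)

Section Compactness.
Import numFieldNormedType.Exports.
Local Open Scope ring_scope.
Local Open Scope classical_set_scope.
Variable R : realType.

(** The covering form of compactness passes from single points to all of [[0, 1]]. Stating the bound
    for all small [d] lets the bounds for several arcs be combined. *)
Lemma near_uniformly_continuous (f : R -> R) (e : R) : continuous f -> 0 < e ->
  \forall d \near 0^'+, forall s t : R, 0 <= s <= 1 -> `|s - t| <= d ->
    `|f s - f t| < e.
Proof.
move=> cf e0.
have /compact_near_coveringP cov : compact `[0 : R, 1] by apply: segment_compact.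
pose P (d s : R) := forall t, `|s - t| <= d -> `|f s - f t| < e.
have : \forall d \near 0^'+, `[0, 1] `<=` P d.
  apply: cov => x _.
  have /cvgrPdist_lt/(_ _ (divr_gt0 e0 (ltr0n R 2))) := cf x.
  case/nbhs_ballP => h /= h0 hball.
  near=> s d => t std.
  have sx : `|x - s| < h / 2.
    by near: s; apply: cvgr_dist_lt; rewrite ?divr_gt0.
  have dh : d < h / 2 by near: d; apply: nbhs_right_lt; rewrite divr_gt0.
  have d0 : 0 < d by near: d; exact: nbhs_right_gt.
  have fs : `|f x - f s| < e / 2 by apply: hball; rewrite /ball /=; lra.
  have xt : `|x - t| < h.
    apply: le_lt_trans (ler_distD s _ _) _.
    by rewrite [h]splitr ltrD // (le_lt_trans std).
  have ft : `|f x - f t| < e / 2 by apply: hball.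
  apply: le_lt_trans (ler_distD (f x) _ _) _.
  by rewrite [e]splitr ltrD // distrC.
apply: filterS => d dP s t s01; apply: dP.
by rewrite /= in_itv.
Unshelve. all: by end_near.
Qed.

(** The distance between the arcs, as a function of both parameters, attains its minimum on the unit
    square, and disjointness makes the minimum positive. *)
Lemma near_separated (f g f' g' : R -> R) :
    continuous f -> continuous g -> continuous f' -> continuous g' ->
    (forall s t : R, 0 <= s <= 1 -> 0 <= t <= 1 ->
      f s = f' t -> g s = g' t -> False) ->
  \forall d \near 0^'+, forall s t : R, 0 <= s <= 1 -> 0 <= t <= 1 ->
    d <= `|f s - f' t| + `|g s - g' t|.
Proof.
move=> cf cg cf' cg' dis.
pose D (u : R * R) := `|f u.1 - f' u.2| + `|g u.1 - g' u.2|.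
have cD : continuous D.
  move=> u; rewrite /D; apply: (@cvgD _ R^o); apply: (@cvg_norm _ R^o);
    apply: (@cvgB _ R^o).
  - by apply: (@cvg_comp _ _ _ fst f); [exact: cvg_fst|exact: cf].
  - by apply: (@cvg_comp _ _ _ snd f'); [exact: cvg_snd|exact: cf'].
  - by apply: (@cvg_comp _ _ _ fst g); [exact: cvg_fst|exact: cg].
  - by apply: (@cvg_comp _ _ _ snd g'); [exact: cvg_snd|exact: cg'].
pose K : set (R * R) := `[0, 1] `*` `[0, 1].
have cK : compact K by apply: compact_setX; exact: segment_compact.
have K0 : K !=set0 by exists (0, 0); split; rewrite /= in_itv /= lexx ler01.
have [c] := @compact_EVT_min _ R D K K0 cK (continuous_subspaceT cD).
rewrite inE => -[]; rewrite /= !in_itv /= => c1 c2 cmin.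
have Dc : 0 < D c.
  rewrite lt0r addr_ge0 // andbT; apply/eqP => /eqP.
  rewrite paddr_eq0 // !normr_eq0 !subr_eq0 => /andP[/eqP ef /eqP eg].
  exact: dis c1 c2 ef eg.
near=> d => s t s01 t01.
apply: (@le_trans _ _ (D c)).
  by apply: ltW; near: d; exact: nbhs_right_lt.
by apply: (cmin (s, t)); rewrite inE; split; rewrite /= in_itv.
Unshelve. all: by end_near.
Qed.

End Compactness.

Section Chains.
Variables (I : eqType) (e : I -> I -> Prop).

(** A version of [path] for relations in [Prop], used for [small_step]. *)
Fixpoint chain x s := if s is y :: s' then e x y /\ chain y s' else True.

Lemma chain_cat x s t : chain x (s ++ t) <-> chain x s /\ chain (last x s) t.
Proof.
elim: s x => [|y s IHs] x /=; first by split=> [|[]].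
by rewrite IHs; tauto.
Qed.

Lemma path_crossing_chain o x s p q : chain x s -> path_crossing o x s p q ->
  exists a b, e a b /\ crossing o a b p q.
Proof.
elim: s x => //= y s IHs x [exy ch].
case E: (crossing o x y p q) => /=; first by exists x, y.
exact: IHs.
Qed.

End Chains.

Lemma paths_crossing_chain (I : eqType) (e e' : I -> I -> Prop) o x s y t :
    chain e x s -> chain e' y t -> paths_crossing o x s y t ->
  exists a b c d, [/\ e a b, e' c d & crossing o a b c d].
Proof.
elim: t y => //= z t IHt y ch [eyz ch'].
case E: (path_crossing o x s y z) => /=; last exact: IHt.
have [a [b [eab cr]]] := path_crossing_chain ch E.
by exists a, b, y, z.
Qed.

(** * Polygonal approximation of drawings *)

Section Drawings.
Import numFieldNormedType.Exports.
Local Open Scope ring_scope.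
Variables (R : realType) (T : finType) (r : rel T).
Variables (X Y : T -> R) (fx fy : T -> T -> R -> R).
Hypothesis fx_continuous : forall u v, r u v -> continuous (fx u v).
Hypothesis fy_continuous : forall u v, r u v -> continuous (fy u v).
Hypothesis f0 : forall u v, r u v -> fx u v 0 = X u /\ fy u v 0 = Y u.
Hypothesis f1 : forall u v, r u v -> fx u v 1 = X v /\ fy u v 1 = Y v.
(* Nothing is assumed about arcs with a common endpoint. *)
Hypothesis f_disjoint : forall u v u' v' (s t : R),
  r u v -> r u' v' -> [disjoint [set u; v] & [set u'; v']] ->
  0 <= s <= 1 -> 0 <= t <= 1 ->
  fx u v s = fx u' v' t -> fy u v s = fy u' v' t -> False.

(** As there are finitely many edges, one [N] and one [d] serve all of them. The factor 16 accounts
    for two coordinates with a bound of [8 d] each in [drawing_no_K5_minor]. *)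
Lemma uniform_separation : exists (N : nat) (d : R), [/\ (0 < N)%N, 0 < d,
  forall u v (s t : R), r u v -> 0 <= s <= 1 -> `|s - t| <= N%:R^-1 ->
    `|fx u v s - fx u v t| < d /\ `|fy u v s - fy u v t| < d &
  forall u v u' v' (s t : R),
    r u v -> r u' v' -> [disjoint [set u; v] & [set u'; v']] ->
    0 <= s <= 1 -> 0 <= t <= 1 ->
    d *+ 16 <= `|fx u v s - fx u' v' t| + `|fy u v s - fy u' v' t|].
Proof.
have [e [e0 esep]] : exists e : R, 0 < e /\ forall u v u' v' (s t : R),
    r u v -> r u' v' -> [disjoint [set u; v] & [set u'; v']] ->
    0 <= s <= 1 -> 0 <= t <= 1 ->
    e <= `|fx u v s - fx u' v' t| + `|fy u v s - fy u' v' t|.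
  near ((0 : R)^'+)%classic => e; exists e.
  split; first by near: e; exact: nbhs_right_gt.
  suff h : forall p : T * T * (T * T),
      [&& r p.1.1 p.1.2, r p.2.1 p.2.2 &
        [disjoint [set p.1.1; p.1.2] & [set p.2.1; p.2.2]]] ->
      forall s t : R, 0 <= s <= 1 -> 0 <= t <= 1 ->
      e <= `|fx p.1.1 p.1.2 s - fx p.2.1 p.2.2 t| +
           `|fy p.1.1 p.1.2 s - fy p.2.1 p.2.2 t|.
    move=> u v u' v' s t ruv ruv' dis; apply: (h (u, v, (u', v'))).
    by rewrite /= ruv ruv' dis.
  near: e; apply: filter_forall => -[[u v] [u' v']] /=.
  have [/and3P[ruv ruv' dis]|nh] := boolP [&& _, _ & _]; last first.
    by apply: nearW.
  have := near_separated (fx_continuous ruv) (fy_continuous ruv)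
     (fx_continuous ruv') (fy_continuous ruv').
  move=> /(_ (fun s t s01 t01 => f_disjoint ruv ruv' dis s01 t01)).
  by apply: filterS => d h _.
pose d := e / 16%:R.
have d0 : 0 < d by rewrite divr_gt0.
have [c [c0 ccont]] : exists c : R, 0 < c /\ forall u v (s t : R),
    r u v -> 0 <= s <= 1 -> `|s - t| <= c ->
    `|fx u v s - fx u v t| < d /\ `|fy u v s - fy u v t| < d.
  near ((0 : R)^'+)%classic => c; exists c.
  split; first by near: c; exact: nbhs_right_gt.
  suff h : forall p : T * T, r p.1 p.2 -> forall s t : R,
      0 <= s <= 1 -> `|s - t| <= c ->
      `|fx p.1 p.2 s - fx p.1 p.2 t| < d /\ `|fy p.1 p.2 s - fy p.1 p.2 t| < d.
    by move=> u v s t ruv; apply: (h (u, v)).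
  near: c; apply: filter_forall => -[u v] /=.
  have [ruv|nr] := boolP (r u v); last by apply: nearW.
  have := near_uniformly_continuous (fx_continuous ruv) d0.
  have := near_uniformly_continuous (fy_continuous ruv) d0.
  by apply: filterS2 => c hy hx _ s t s01 st; split; [apply: hx|apply: hy].
have [N Nc] : exists N : nat, c^-1 < N%:R.
  by exists (Num.truncn c^-1).+1; rewrite truncnS_gt.
have N0 : (0 < N)%N by rewrite -(ltr0n R); apply: lt_trans Nc; rewrite invr_gt0.
exists N, d; split=> // [u v s t ruv s01 st|u v u' v' s t *].
  apply: ccont => //; apply: le_trans st _.
  by rewrite invf_ple ?posrE ?ltr0n // ltW.
have -> : d *+ 16 = e by rewrite /d -[LHS]mulr_natr divfK // pnatr_eq0.
exact: esep.
Unshelve. all: by end_near.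
Qed.


Section Subdivision.
Variable N : nat.
Hypothesis N_gt0 : (0 < N)%N.

(* [inr (u, v, m)] is the [m]-th of the points dividing the edge from [u] to
   [v] into [N] parts of equal parameter length. *)
Definition node : finType := (T + T * T * 'I_N.+1)%type.

Definition node_x (a : node) := match a with
  | inl u => X u | inr (u, v, m) => fx u v (m%:R / N%:R) end.
Definition node_y (a : node) := match a with
  | inl u => Y u | inr (u, v, m) => fy u v (m%:R / N%:R) end.

Definition node_in (U : {set T}) (a : node) := match a with
  | inl u => u \in U | inr (u, v, _) => (u \in U) && (v \in U) end.

(** The start [inl u] is omitted so that consecutive edges concatenate. The nodes with [m = 0] and
    [m = N] repeat the positions of the two ends, so the first and last steps have length zero. *)
Definition edge_nodes u v : seq node :=
  rcons [seq inr (u, v, inord m) | m <- iota 0 N.+1] (inl v).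

Fixpoint walk_nodes (p : seq T) (u : T) : seq node :=
  if p is v :: p' then edge_nodes u v ++ walk_nodes p' v else [::].

Lemma walk_nodes_cons v p u :
  walk_nodes (v :: p) u = edge_nodes u v ++ walk_nodes p v.
Proof. by []. Qed.

(** Two parameters at most [1 / N] apart on one edge inside [U] are the data to which
    [uniform_separation] applies. *)
Definition small_step (U : {set T}) (a b : node) := exists u v (s t : R),
  [/\ r u v, 0 <= s <= 1, `|s - t| <= N%:R^-1,
      [/\ u \in U, v \in U, node_in U a & node_in U b] &
      [/\ node_x a = fx u v s, node_y a = fy u v s,
          node_x b = fx u v t & node_y b = fy u v t]].

Lemma last_walk_nodes p u : last (inl u) (walk_nodes p u) = inl (last u p).
Proof.
elim: p u => //= v p IHp u.
by rewrite last_cat last_rcons IHp.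
Qed.

Lemma node_in_walk_nodes (U : {set T}) p u : u \in U -> {subset p <= U} ->
  {in inl u :: walk_nodes p u, forall a, node_in U a}.
Proof.
elim: p u => [|v p IHp] u uU pU a.
  by rewrite inE => /eqP->.
have vU : v \in U by apply: pU; rewrite mem_head.
rewrite inE walk_nodes_cons mem_cat mem_rcons inE.
case/orP=> [/eqP->//|/orP[/orP[/eqP->//|]|aw]].
  by case/mapP => m _ ->; rewrite /= uU.
by apply: (IHp v) => [//|w wp|]; [apply: pU|]; rewrite inE ?wp ?aw orbT.
Qed.

Lemma chain_edge_nodes (U : {set T}) u v : r u v -> u \in U -> v \in U ->
  chain (small_step U) (inl u) (edge_nodes u v).
Proof.
move=> ruv uU vU; have N0 : 0 < N%:R :> R by rewrite ltr0n.
have frac m : (m <= N)%N -> 0 <= (m%:R / N%:R : R) <= 1.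
  by move=> mN; rewrite divr_ge0 // ler_pdivrMr // mul1r ler_nat.
have step0 : small_step U (inl u) (inr (u, v, inord 0)).
  exists u, v, 0, 0; split; rewrite ?lexx ?ler01 ?subrr ?normr0 ?invr_ge0 ?ler0n //=.
    by rewrite uU.
  by rewrite inordK // mul0r; have [] := f0 ruv.
have stepN : small_step U (inr (u, v, inord N)) (inl v).
  exists u, v, 1, 1; split; rewrite ?lexx ?ler01 ?subrr ?normr0 ?invr_ge0 ?ler0n //=.
    by rewrite uU.
  by rewrite inordK // divff ?gt_eqF //; have [] := f1 ruv.
have step m : (m < N)%N ->
    small_step U (inr (u, v, inord m)) (inr (u, v, inord m.+1)).
  move=> mN; exists u, v, (m%:R / N%:R), (m.+1%:R / N%:R); split=> //=.
  - by apply: frac; apply: ltnW.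
  - by rewrite -mulrBl -natr1 opprD addrA subrr add0r mulN1r normrN ger0_norm
      ?invr_ge0.
  - by rewrite uU.
  - by rewrite !inordK // ltnW.
rewrite /edge_nodes -cats1 /=; split=> //.
have chn k m : (k + m)%N = N -> chain (small_step U) (inr (u, v, inord k))
    ([seq inr (u, v, inord j) | j <- iota k.+1 m] ++ [:: inl v]).
  elim: m k => [|m IHm] k e /=; first by rewrite addn0 in e; rewrite e.
  by split; [apply: step; lia | apply: IHm; lia].
exact: chn.
Qed.

Lemma chain_walk_nodes (U : {set T}) p u : u \in U -> path (induced r U) u p ->
  chain (small_step U) (inl u) (walk_nodes p u).
Proof.
elim: p u => // v p IHp u uU.
rewrite walk_nodes_cons [path _ _ _]/= => /andP[/and3P[_ vU ruv] pp].
apply/chain_cat; split; first exact: chain_edge_nodes.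
by rewrite last_rcons; apply: IHp.
Qed.

End Subdivision.

(** Representatives of the branch sets are joined by walks inside unions of two branch sets. Walks
    without a common end use disjoint sets of vertices, so their steps follow arcs that are far
    apart and cannot cross even after perturbation, against [K5_paths_crossing]. *)
Theorem drawing_no_K5_minor : ~ K5_minor r.
Proof.
case=> B [B0 Bd Bc].
have /choice[v vB] : forall i, exists x, x \in B i by move=> i; apply/set0Pn.
have /choice[p pP] : forall ij : 'I_5 * 'I_5, exists p, ij.1 != ij.2 ->
    path (induced r (B ij.1 :|: B ij.2)) (v ij.1) p /\ last (v ij.1) p = v ij.2.
  move=> [i j] /=; have [->|ij] := eqVneq i j; first by exists [::].
  have /connectP[p pp pl] := Bc i j ij (v i) (v j)
    (fintype.subsetP (finset.subsetUl _ _) _ (vB i))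
    (fintype.subsetP (finset.subsetUr _ _) _ (vB j)).
  by exists p.
have [N [d [N0 d0 dcont dsep]]] := uniform_separation.
have [x' [y' [xx' yy' gen]]] :=
  general_position_approx (@node_x N) (@node_y N) d0.
pose w i j := walk_nodes N (p (i, j)) (v i).
have vU i j : v i \in B i :|: B j by rewrite inE vB.
have pU i j : i != j -> {subset p (i, j) <= B i :|: B j}.
  move=> ij; have [/= + _] := pP (i, j) ij; elim: (p _) (v i) => //= u q IHq z.
  case/andP=> /and3P[_ uB _] /IHq qB t; rewrite inE => /predU1P[->//|]; exact: qB.
have win i j a : i != j -> a \in inl (v i) :: w i j -> node_in (B i :|: B j) a.
  by move=> ij; apply: node_in_walk_nodes (vU i j) (pU i j ij) a.
have Udis i j k l : uniq [:: i; j; k; l] ->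
    [disjoint B i :|: B j & B k :|: B l].
  rewrite /= !inE !negb_or => /and4P[/and3P[_ ik il] /andP[jk jl] _ _].
  by apply: disjoint_setUU; apply: Bd.
have in_dis (U W : {set T}) (a : node N) :
    [disjoint U & W] -> node_in U a -> node_in W a -> False.
  move=> dis; case: a => [z|[[z z'] m]] /=; first by move=> /(disjointFr dis)->.
  by case/andP=> /(disjointFr dis)->.
have wdis i j k l : uniq [:: i; j; k; l] ->
    {in inl (v k) :: w k l, forall q, q \notin inl (v i) :: w i j}.
  move=> u q qkl; apply/negP => qij.
  have [ij kl] : i != j /\ k != l.
    by move: u; rewrite /= !inE !negb_or => /and4P[/and3P[]].
  exact: in_dis (Udis _ _ _ _ u) (win _ _ _ ij qij) (win _ _ _ kl qkl).
have vinj : injective v.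
  move=> i j e; apply/eqP; apply: contraT => ij.
  by have := disjointFr (Bd _ _ ij) (vB i); rewrite e vB.
apply: (@K5_paths_crossing _ (ccw x' y') _ _ _ _ _ (fun i => inl (v i)) w).
- exact: ccw_degen.
- exact: ccw_rot.
- exact: ccw_swap gen.
- exact: ccw_affine gen.
- exact: ccw_GP gen.
- by move=> i j [/vinj].
- move=> i j ij; rewrite /w last_walk_nodes.
  by have [_ ->] := pP (i, j) ij.
- exact: wdis.
move=> i j k l u; apply/negP.
have [ij kl] : i != j /\ k != l.
  by move: u; rewrite /= !inE !negb_or => /and4P[/and3P[]].
have [pij _] := pP (i, j) ij; have [pkl _] := pP (k, l) kl.
move=> /(paths_crossing_chain (chain_walk_nodes N0 (vU i j) pij)
  (chain_walk_nodes N0 (vU k l) pkl)) [a [b [c [e [sab sce cr]]]]].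
have dU := Udis _ _ _ _ u.
have dis (U W : {set T}) (a1 a2 : node N) :
    [disjoint U & W] -> node_in U a1 -> node_in W a2 -> a1 != a2.
  move=> UW a1U a2W; apply/eqP => e12; rewrite e12 in a1U.
  exact: in_dis UW a1U a2W.
case: sab => [u1 [v1 [s [s' [r1 s01 ss' [u1U v1U aU bU] [xa ya xb yb]]]]]].
case: sce => [u2 [v2 [t [t' [r2 t01 tt' [u2U v2U cU eU] [xc yc xe ye]]]]]].
have uabce : uniq [:: a; b; c; e].
  have ac := dis _ _ a c dU aU cU; have ae := dis _ _ a e dU aU eU.
  have bc := dis _ _ b c dU bU cU; have be := dis _ _ b e dU bU eU.
  rewrite /= !inE !negb_or ac ae bc be !andbT.
  apply/andP; split; apply: contraTneq cr => ->.
    by rewrite /crossing !ccw_degen.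
  by rewrite /crossing !ccw_degen andbF.
have [cx cy] := crossing_dist gen cr uabce.
have [sx sy] := dcont _ _ _ _ r1 s01 ss'; have [tx ty] := dcont _ _ _ _ r2 t01 tt'.
have dis12 : [disjoint [set u1; v1] & [set u2; v2]].
  apply: disjointWl (_ : _ \subset B i :|: B j) _.
    by rewrite finset.subUset !finset.sub1set u1U.
  by apply: disjointWr dU; rewrite finset.subUset !finset.sub1set u2U.
have := dsep _ _ _ _ s t r1 r2 dis12 s01 t01.
rewrite -xa -xc -ya -yc -xb -xe -yb -ye in sx sy tx ty *.
(* The perturbation moves points and steps by less than d, so that crossing
   perturbed steps start within 8 d of each other in either coordinate. *)
suff bound (z z' : node N -> R) : (forall q, `|z' q - z q| < d) ->
    `|z' a - z' c| <= `|z' a - z' b| + `|z' c - z' e| ->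
    `|z a - z b| < d -> `|z c - z e| < d -> `|z a - z c| < d *+ 8.
  move=> far; have := bound _ _ xx' cx sx tx; have := bound _ _ yy' cy sy ty.
  by move: far; lra.
move=> zz' cz sz tz.
(* Perturbation changes a distance by at most [2 d]: the two perturbed steps are shorter than [3 d]
   each, and returning to the original points costs [2 d] more, which gives [8 d]. *)
have tri (q q' : node N) : `|z' q - z' q'| <= `|z q - z q'| + d *+ 2.
  have -> : z' q - z' q' = (z q - z q') + (z' q - z q) + - (z' q' - z q') by ring.
  have := ler_normD (z q - z q' + (z' q - z q)) (- (z' q' - z q')).
  have := ler_normD (z q - z q') (z' q - z q); rewrite normrN.
  have := zz' q; have := zz' q'; lra.
have tri' : `|z a - z c| <= `|z' a - z' c| + d *+ 2.
  have -> : z a - z c = (z' a - z' c) + - (z' a - z a) + (z' c - z c) by ring.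
  have := ler_normD (z' a - z' c + - (z' a - z a)) (z' c - z c).
  have := ler_normD (z' a - z' c) (- (z' a - z a)); rewrite normrN.
  have := zz' a; have := zz' c; lra.
have := tri a b; have := tri c e; lra.
Qed.

End Drawings.

(** * Drawings from topological embeddings *)

Section PlanarGraph.
Import numFieldNormedType.Exports.
Local Open Scope ring_scope.
Variables (R : realType) (n : nat) (G : simplicial_complex n).

Local Notation A := (geometric_realization R G).

Definition segment_point (u v : 'I_n) (t : R) : 'rV[R]_n :=
  (1 - t) *: delta_mx ord0 u + t *: delta_mx ord0 v.

(** Retraction of the line onto [[0, 1]], used to extend the parametrisation of an edge to a
    continuous function on the whole line. *)
Definition clamp (t : R) : R := Num.max 0 (Num.min 1 t).

Lemma clamp_itv t : 0 <= clamp t <= 1.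
Proof.
rewrite /clamp le_max lexx /= ge_max ler01 /= ge_min lexx; lra.
Qed.

Lemma clampE t : 0 <= t <= 1 -> clamp t = t.
Proof. by case/andP=> t0 t1; rewrite /clamp (min_idPr t1) (max_idPr t0). Qed.

Lemma clamp_continuous : continuous clamp.
Proof.
apply: (@max_fun_continuous _ R R (fun=> 0)); first exact: cst_continuous.
apply: (@min_fun_continuous _ R R (fun=> 1)); first exact: cst_continuous.
by move=> t; exact: cvg_id.
Qed.

Lemma segment_pointE u v t j :
  segment_point u v t ord0 j = (1 - t) * (j == u)%:R + t * (j == v)%:R.
Proof. by rewrite !mxE. Qed.

Lemma segment_point_realization u v t : adjacent G u v -> 0 <= t <= 1 ->
  A (segment_point u v t).
Proof.
case/andP=> uv uvG /andP[t0 t1]; split.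
- by move=> i; rewrite segment_pointE addr_ge0 // mulr_ge0 ?ler0n ?subr_ge0.
- under eq_bigr do rewrite segment_pointE.
  rewrite big_split /= -!mulr_sumr.
  have one w : \sum_(i < n) (i == w)%:R = 1 :> R.
    by rewrite (bigD1 w) //= eqxx big1 ?addr0 // => i /negPf->.
  by rewrite !one; ring.
- apply: faces_closed uvG _; apply/fintype.subsetP => j; rewrite !inE segment_pointE.
  by apply: contraNT; rewrite negb_or => /andP[/negPf-> /negPf->]; rewrite !mulr0 addr0.
Qed.

(** At a point of the first segment one of the coordinates at [u] and [v] is non-zero, while on the
    second segment both vanish. *)
Lemma segment_point_disjoint u v u' v' s t :
  [disjoint [set u; v] & [set u'; v']] -> 
  segment_point u v s <> segment_point u' v' t.
Proof.
move=> dis e; have uN : u \notin [set u'; v'] by rewrite (disjointFr dis) // !inE eqxx.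
have vN : v \notin [set u'; v'] by rewrite (disjointFr dis) // !inE eqxx orbT.
move: uN vN; rewrite !inE !negb_or.
move=> /andP[/negPf uu' /negPf uv'] /andP[/negPf vu' /negPf vv'].
have := congr1 (fun p : 'rV[R]_n => p ord0 u) e.
have := congr1 (fun p : 'rV[R]_n => p ord0 v) e.
rewrite /= !segment_pointE !eqxx uu' uv' vu' vv' !mulr0 addr0.
by have [_|_] := eqVneq u v; rewrite !(mulr0, mulr1) => h h'; clear e; lra.
Qed.

Lemma segment_point_continuous u v : continuous (segment_point u v).
Proof.
move=> t; apply: cvgD; apply: cvgZr_tmp; last exact: cvg_id.
by apply: cvgB; [exact: cvg_cst|exact: cvg_id].
Qed.

(** The embedding is injective on the realization and segments of disjoint edges are disjoint, so
    the images of the segments form a drawing as in [drawing_no_K5_minor]. *)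
Theorem planar_no_K5_minor : planar_graph R G -> ~ K5_minor (adjacent G).
Proof.
case=> P [h [g [ch _ hK _]]].
(* [valL_] extends the embedding by 0 outside the realization; continuity is claimed only on the
   subspace. *)
pose H := valL_ (0 : 'rV[R]_2) (fun p : set_type A => set_val (h p)).
have cH : continuous (H : subspace A -> 'rV[R]_2).
  apply/subspace_valL_continuousP'; move=> x; apply: continuous_comp.
    exact: ch.
  exact: initial_continuous.
have Hinj p q : A p -> A q -> H p = H q -> p = q.
  have inj : injective (fun p : set_type A => set_val (h p)).
    by move=> x y /val_inj; exact: can_inj.
  move=> Ap Aq e; apply: ((valL_injP (0 : 'rV[R]_2) _).2 inj) => //; exact/mem_set.
pose f u v t := H (segment_point u v (clamp t)).
have cf u v : adjacent G u v -> continuous (f u v).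
  move=> uv t; have Aseg s : A (segment_point u v (clamp s)).
    exact: segment_point_realization uv (clamp_itv s).
  have := (subspace_continuousP A H).1 cH _ (Aseg t); apply: cvg_trans.
  move=> B /= HB.
  have cs : {for t, continuous (fun s => segment_point u v (clamp s))}.
    apply: continuous_comp; first exact: clamp_continuous.
    exact: segment_point_continuous.
  have hs : (\forall s \near t, A (segment_point u v (clamp s)) -> B (f u v s)) :=
    cs _ HB.
  by apply: filterS hs => s; apply.
have coord (i : 'I_2) u v : adjacent G u v -> continuous (fun t => f u v t ord0 i).
  move=> uv t; apply: (@continuous_comp _ _ _ (f u v) (fun M => M ord0 i)).
    exact: cf.
  exact: coord_continuous.
pose V0 u := H (delta_mx ord0 u).
apply: (@drawing_no_K5_minor R _ (adjacent G)
  (fun u => V0 u ord0 0) (fun u => V0 u ord0 1)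
  (fun u v t => f u v t ord0 0) (fun u v t => f u v t ord0 1)).
- exact: coord.
- exact: coord.
- move=> u v _; rewrite /f clampE ?lexx ?ler01 //.
  by rewrite /segment_point subr0 scale1r scale0r addr0.
- move=> u v _; rewrite /f clampE ?lexx ?ler01 //.
  by rewrite /segment_point subrr scale1r scale0r add0r.
- move=> u v u' v' s t uv uv' dis s01 t01; rewrite /f !clampE // => e0 e1.
  apply: (@segment_point_disjoint u v u' v' s t dis); apply: Hinj.
  + exact: segment_point_realization.
  + exact: segment_point_realization.
  + apply/rowP => i; have [->|->] // : i = 0 \/ i = 1.
    by case: i => [[|[|//]] ?]; [left|right]; apply/val_inj.
Qed.

End PlanarGraph.

Theorem corollary4p9 (R : realType) (k : fieldType) (n : nat)
    (Delta : simplicial_complex n) :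
  ([pchar k] =i pred0)%R ->
  pseudomanifold2 Delta ->
  without_boundary Delta ->
  planar_triangulation R Delta ->
  WLP_in_degree k Delta 2 <-> ~ eulerian (graph_of Delta).
Proof.
move=> char0 pseudo no_boundary [_ planar]; split; last exact: WLP_not_eulerian.
move=> wlp eul.
have noK5 := planar_no_K5_minor planar.
have bound := no_K5_minor_card_edges pseudo noK5.
have [c col] := eulerian_two_colourable pseudo no_boundary eul bound.
exact (WLP_not_two_colourable char0 pseudo no_boundary col wlp).
Qed.
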